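(* Let $\beta>-2$ and, for $n\ge1$, let $T_n$ be the random tree with $n$ leaves of Aldous' $\beta$-splitting model. (1) If $\beta\ge-1$, then $T_n$ converges in distribution, with respect to the local limit topology, to the complete infinite binary tree (in which every vertex has two children) as $n\to\infty$. (2) If $\beta\in(-2,-1)$, let $X$ have the beta geometric distribution with parameters $(-1-\beta,2+\beta)$, and let $q_\infty$ be the probability measure on $\mathcal P_\infty$ given by $q_\infty(\infty,k)=\mathbb P[X=k-1]$ for $k\ge1$ and $q_\infty(\lambda)=0$ if $p(\lambda)\ne2$ or $m_\infty(\lambda)\ne1$. Then $T_n$ converges in distribution to $\mathrm{MB}^{\mathcal L,q,q_\infty}_\infty$ with respect to the local limit topology as $n\to\infty$.
   Context: Trees are rooted, unordered, with finite numbers of children, identified up to root- and parent-preserving bijections. For an integer $R\ge0$, $t|_R$ is the subtree of vertices at graph distance at most $R$ from the root; the local limit topology is induced by $d_{\mathrm{loc}}(t,s)=\exp[-\inf\{R\ge0:t|_R\ne s|_R\}]$. $\mathcal P_\infty$ is the set of finite non-increasing sequences in $\{1,2,\dots\}\cup\{\infty\}$ with at least one infinite term; $p(\lambda)$ is the length of $\lambda$ and $m_\infty(\lambda)$ its number of infinite terms. $\beta$-splitting model. For $n\ge2$, $q_n$ is the probability measure on partitions of $n$ into two parts given, for $1\le k\le n/2$, by $$q_n(n-k,k)=\frac{2-\mathbf 1_{2k=n}}{Z_n}\,\frac{\Gamma(n-k+1+\beta)}{(n-k)!}\,\frac{\Gamma(k+1+\beta)}{k!},$$ $Z_n$ being the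 normalising constant; $q_1$ is the Dirac mass at the empty partition $\varnothing$. $T_1$ is the single-vertex tree, and for $n\ge2$ the law $\mathrm{MB}^{\mathcal L,q}_n$ of $T_n$ is defined recursively: take $(n-k,k)$ with law $q_n$, and given it attach the roots of two independent trees distributed as $T_{n-k}$ and $T_k$ by edges to a new common root. The beta geometric distribution with parameters $(\theta,1-\theta)$, $\theta\in(0,1)$, is $\mathbb P[X=n]=\frac{\theta\,\Gamma(n+1-\theta)}{\Gamma(1-\theta)\,(n+1)!}$, $n\ge0$. $\mathrm{MB}^{\mathcal L,q,q_\infty}_\infty$ is the law of the tree obtained from an infinite branch $v_0$ (root)$,v_1,v_2,\dots$ by attaching, for each $n\ge0$, the root of a tree $\tau_n$ by an edge to $v_n$, where $(K_n,\tau_n)_{n\ge0}$ are i.i.d., $\mathbb P[K_n=k]=q_\infty(\infty,k)$ for $k\ge1$, and given $K_n=k$, $\tau_n$ is distributed as $T_k$. *)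

(* Defs.v *)
From HB Require Import structures.
From mathcomp Require Import all_boot all_order all_algebra.
From mathcomp Require Import generic_quotient.
From mathcomp Require Import all_classical all_reals all_analysis.
From mathcomp Require Import measurable_realfun.

Set Implicit Arguments.
Unset Strict Implicit.
Unset Printing Implicit Defensive.

Import Order.TTheory GRing.Theory Num.Theory.
Import numFieldNormedType.Exports.

Local Open Scope classical_set_scope.
Local Open Scope ring_scope.

(* A locally finite rooted tree is first given with a Ulam-Harris labelling: a
   set of words closed under removal of the last letter.  The labels of the
   children of a vertex form an arbitrary finite set, not an initial segment,
   since they are forgotten in [tree]. *)
Definition parent (u : seq nat) : seq nat := take (size u).-1 u.
Arguments parent : simpl never.

Definition is_labelled_tree (t : set (seq nat)) : Prop :=
  [/\ t [::], (forall u, t u -> t (parent u)) &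
      forall u, finite_set [set i | t (rcons u i)]].

Definition ltree := {t : set (seq nat) | `[< is_labelled_tree t >]}.
HB.instance Definition _ := Choice.on ltree.

Definition ltree_of (t : set (seq nat)) (ht : is_labelled_tree t) : ltree :=
  exist _ t (asboolT ht).

Lemma ltreeP (t : ltree) : is_labelled_tree (val t).
Proof. by case: t => t /= /asboolP. Qed.

Lemma parent_rcons u i : parent (rcons u i) = u.
Proof. by rewrite /parent size_rcons/= -cats1 take_size_cat. Qed.

Definition ltree_iso (t s : ltree) : Prop :=
  exists f : seq nat -> seq nat,
    [/\ set_bij (val t) (val s) f, f [::] = [::] &
        forall u, val t u -> f (parent u) = parent (f u)].

Lemma ltree_iso_refl t : ltree_iso t t.
Proof. by exists id; split => //; split => //= u tu; exists u. Qed.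

Lemma ltree_iso_sym t s : ltree_iso t s -> ltree_iso s t.
Proof.
move=> [f [[fs finj fsurj] f0 fp]].
have /choice[g gP] : forall v, exists u, val s v -> val t u /\ f u = v.
  move=> v; have [sv|nsv] := pselect (val s v); last by exists [::].
  by have [u tu <-] := fsurj v sv; exists u.
have gt v : val s v -> val t (g v) by move=> /gP[].
have gK v : val s v -> f (g v) = v by move=> /gP[].
have [t0 tp _] := ltreeP t; have [s0 sp _] := ltreeP s.
have gf u v : val t u -> val s v -> f u = v -> g v = u.
  by move=> tu sv fuv; apply: finj; rewrite ?inE//; [exact: gt|rewrite gK].
exists g; split.
- split=> //.
  + move=> v w /set_mem sv /set_mem sw gvw.
    by rewrite -(gK _ sv) gvw gK.
  + move=> u tu; exists (f u); first exact: fs.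
    by apply: gf => //; exact: fs.
- exact: gf.
- move=> v sv; apply: gf; [exact/tp/gt|exact: sp|].
  by rewrite fp ?gK//; exact: gt.
Qed.

Lemma ltree_iso_trans s t r :
  ltree_iso t s -> ltree_iso s r -> ltree_iso t r.
Proof.
move=> [f [[fs finj fsurj] f0 fp]] [g [[gs ginj gsurj] g0 gp]].
exists (g \o f); split.
- split.
  + by move=> u tu; exact/gs/fs.
  + move=> u v tu tv /= /ginj fuv; apply: finj => //.
    by apply: fuv; rewrite inE; apply: fs; rewrite -inE.
  + move=> w rw; have [v sv <-] := gsurj w rw.
    by have [u tu <-] := fsurj v sv; exists u.
- by rewrite /= f0.
- by move=> u tu /=; rewrite fp// gp//; exact: fs.
Qed.

Definition ltree_equiv (t s : ltree) : bool := `[< ltree_iso t s >].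

Lemma ltree_equiv_class : equiv_class_of ltree_equiv.
Proof.
split=> [t|t s|s t r].
- exact/asboolP/ltree_iso_refl.
- by apply/asboolP/asboolP; exact: ltree_iso_sym.
- by move=> /asboolP ts /asboolP sr; apply/asboolP; exact: ltree_iso_trans sr.
Qed.

Canonical ltree_equiv_rel := EquivRelPack ltree_equiv_class.

Definition tree := {eq_quot ltree_equiv_rel}%qT.
HB.instance Definition _ := Choice.on tree.
HB.instance Definition _ := EqQuotient.on tree.

Lemma pi_ltreeP (t s : ltree) :
  \pi_tree%qT t = \pi_tree%qT s <-> ltree_iso t s.
Proof.
by split=> [/eqquotP/asboolP|h]//; apply/eqquotP/asboolP.
Qed.

Lemma single_is_labelled_tree : is_labelled_tree [set [::]].
Proof.
split=> // [_ ->//|u].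
rewrite (_ : [set i | _] = set0); first exact: finite_set0.
by rewrite -subset0 => i /= /(congr1 size); rewrite size_rcons.
Qed.

Definition leaf : tree := \pi_tree%qT (ltree_of single_is_labelled_tree).

HB.instance Definition _ := isPointed.Build tree leaf.

Lemma truncation_is_labelled_tree (k : nat) (t : ltree) :
  is_labelled_tree [set u | val t u /\ (size u <= k)%N].
Proof.
have [t0 tp tf] := ltreeP t; split=> [//|u [tu uk]|u].
- split; first exact: tp.
  by rewrite size_take_min (leq_trans (geq_minr _ _)).
- by apply: sub_finite_set (tf u) => i [].
Qed.

Lemma ltree_iso_size (t s : ltree) f :
    set_bij (val t) (val s) f -> f [::] = [::] ->
    (forall u, val t u -> f (parent u) = parent (f u)) ->
  forall u, val t u -> size (f u) = size u.
Proof.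
move=> [_ finj _] f0 fp; have [t0 tp _] := ltreeP t.
elim/last_ind => [|u i IH] tu; first by rewrite f0.
have tu' : val t u by rewrite -(parent_rcons u i); exact: tp.
have fu : f u = parent (f (rcons u i)) by rewrite -fp// parent_rcons.
rewrite size_rcons -(IH tu') fu.
have : f (rcons u i) <> [::].
  rewrite -f0 => /finj; rewrite !inE => /(_ tu t0)/(congr1 size).
  by rewrite size_rcons.
by case/lastP: (f (rcons u i)) => // v j _; rewrite parent_rcons size_rcons.
Qed.

Definition ltruncation (k : nat) (t : ltree) : ltree :=
  ltree_of (truncation_is_labelled_tree k t).

Lemma ltruncation_iso k t s :
  ltree_iso t s -> ltree_iso (ltruncation k t) (ltruncation k s).
Proof.
move=> [f [fb f0 fp]]; have fsize := ltree_iso_size fb f0 fp.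
case: fb => fs finj fsurj; exists f; split => //.
- split.
  + by move=> u [tu uk]; split; [exact: fs|rewrite fsize].
  + move=> u v; rewrite !inE/= => -[tu _] [tv _]; apply: finj; exact: mem_set.
  + move=> v [sv vk]; have [u tu uv] := fsurj v sv.
    by exists u => //; split => //; rewrite -fsize// uv.
- by move=> u [tu _]; exact: fp.
Qed.

(* [truncation k t] is $t|_k$: the distance of a word to the root is its size. *)
Definition truncation (k : nat) (t : tree) : tree :=
  \pi_tree%qT (ltruncation k (repr t)).

Lemma iso_repr_pi (t : ltree) : ltree_iso (repr (\pi_tree%qT t)) t.
Proof. by apply/pi_ltreeP; rewrite reprK. Qed.

Lemma truncation_pi k t :
  truncation k (\pi_tree%qT t) = \pi_tree%qT (ltruncation k t).
Proof. by apply/pi_ltreeP/ltruncation_iso/iso_repr_pi. Qed.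

Definition join_words (t s : set (seq nat)) : set (seq nat) :=
  [set u | match u with
           | [::] => True
           | 0%N :: v => t v
           | 1%N :: v => s v
           | _ => False
           end].

Lemma parent_cons i u : parent (i :: u) = if u is [::] then [::] else i :: parent u.
Proof. by case: u. Qed.

Lemma join_is_labelled_tree (t s : ltree) :
  is_labelled_tree (join_words (val t) (val s)).
Proof.
have [t0 tp tf] := ltreeP t; have [s0 sp sf] := ltreeP s; split=> //.
- by move=> [|[|[|i]] [|j u]]//; rewrite parent_cons; [exact: tp|exact: sp].
- case=> [|[|[|i]] u]/=; [|exact: tf|exact: sf|].
  + by apply: (@sub_finite_set _ _ `I_2) => //; move=> [|[|i]].
  + by rewrite (_ : [set _ | _] = set0)//; exact/seteqP.
Qed.

Definition ljoin (t s : ltree) : ltree := ltree_of (join_is_labelled_tree t s).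

Lemma ljoin_iso t t' s s' :
  ltree_iso t t' -> ltree_iso s s' -> ltree_iso (ljoin t s) (ljoin t' s').
Proof.
move=> [f [[fs finj fsurj] f0 fp]] [g [[gs ginj gsurj] g0 gp]].
exists (fun u => match u with
                 | 0%N :: v => 0%N :: f v
                 | 1%N :: v => 1%N :: g v
                 | _ => u
                 end); split => //.
- split.
  + by move=> [|[|[|i]] u]//=; [exact: fs|exact: gs].
  + move=> [|[|[|i]] u] [|[|[|j]] v]//; rewrite !inE//= => hu hv [].
      by move=> /finj ->//; exact: mem_set.
    by move=> /ginj ->//; exact: mem_set.
  + move=> [|[|[|i]] u]//=.
    * by exists [::].
    * by move=> /fsurj[v tv <-]; exists (0%N :: v).
    * by move=> /gsurj[v tv <-]; exists (1%N :: v).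
- move=> [//|[|[|i]] u]//= tu; rewrite !parent_cons.
  + case: u tu => [_|j u tu]; first by rewrite f0.
    rewrite fp//; case E : (f (j :: u)) => //.
    by have := ltree_iso_size (And3 fs finj fsurj) f0 fp tu; rewrite E.
  + case: u tu => [_|j u tu]; first by rewrite g0.
    rewrite gp//; case E : (g (j :: u)) => //.
    by have := ltree_iso_size (And3 gs ginj gsurj) g0 gp tu; rewrite E.
Qed.

(* The roots of [t] and [s] are attached by edges to a new common root. *)
Definition join (t s : tree) : tree :=
  \pi_tree%qT (ljoin (repr t) (repr s)).

Lemma join_pi t s :
  join (\pi_tree%qT t) (\pi_tree%qT s) = \pi_tree%qT (ljoin t s).
Proof. by apply/pi_ltreeP; apply: ljoin_iso; exact: iso_repr_pi. Qed.

(* The spine is 0^n, and tau n hangs below the child 0^n 1 of 0^n. *)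
Definition spine_words (tau : nat -> set (seq nat)) : set (seq nat) :=
  [set u | exists n : nat, u = nseq n 0%N \/
           exists2 v, tau n v & u = nseq n 0%N ++ 1%N :: v].

Lemma spine_words_rec tau :
  spine_words tau = join_words (spine_words (tau \o S)) (tau 0%N).
Proof.
apply/seteqP; split=> [u [n]|[|[|[|i]] u]]//=.
- case=> [->|[v tv ->]]; first by case: n => //= n; exists n; left.
  by case: n tv => //= n tv; exists n; right; exists v.
- by move=> _; exists 0%N; left.
- by move=> [n [->|[v tv ->]]]; exists n.+1; [left|right; exists v].
- by move=> tu; exists 0%N; right; exists u.
Qed.

Lemma spine_is_labelled_tree (tau : nat -> ltree) :
  is_labelled_tree (spine_words (val \o tau)).
Proof.
split.
- by exists 0%N; left.
- move=> u; elim: u tau => [//|i u IH] tau.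
  rewrite spine_words_rec parent_cons.
  case: i => [|[|i]]//; case: u IH => [//|j u] IH /=.
    by move=> h; exact: (IH (tau \o S)) h.
  by case: (ltreeP (tau 0%N)) => _ + _; exact.
- move=> u; elim: u tau => [|i u IH] tau; rewrite spine_words_rec/=.
    by apply: (@sub_finite_set _ _ `I_2) => //; move=> [|[|i]].
  case: i => [|[|i]]; first exact: (IH (tau \o S)).
    by case: (ltreeP (tau 0%N)) => _ _; exact.
  by rewrite (_ : [set _ | _] = set0)//; exact/seteqP.
Qed.

Definition lspine (tau : nat -> ltree) : ltree :=
  ltree_of (spine_is_labelled_tree tau).

Lemma lspine_iso (tau tau' : nat -> ltree) :
  (forall n, ltree_iso (tau n) (tau' n)) ->
  ltree_iso (lspine tau) (lspine tau').
Proof.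
move=> /choice[f fP].
pose fix h (f : nat -> seq nat -> seq nat) (u : seq nat) : seq nat :=
  match u with
  | 0%N :: v => 0%N :: h (f \o S) v
  | 1%N :: v => 1%N :: f 0%N v
  | _ => u
  end.
exists (h f); split => //; rewrite /=.
- split.
  + move=> u; elim: u f tau tau' fP => [|i u IH] f tau tau' fP.
      by move=> _; exists 0%N; left.
    rewrite spine_words_rec [in X in _ -> X]spine_words_rec.
    case: i => [|[|i]]//=; first exact: (IH _ (tau \o S) (tau' \o S) (fun n => fP n.+1)).
    by have [[fs _ _] _ _] := fP 0%N; exact: fs.
  + move=> u v; rewrite !inE.
    elim: u v f tau tau' fP => [|i u IH] [|j v] f tau tau' fP //.
    * by rewrite spine_words_rec/=; case: j => [|[|j]].
    * by case: i => [|[|i]].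
    rewrite !(spine_words_rec (val \o tau)).
    case: i j => [|[|i]] [|[|j]]//= hu hv [].
      by move/(IH v (f \o S) (tau \o S) (tau' \o S) (fun n => fP n.+1)) => ->.
    have [[_ finj _] _ _] := fP 0%N.
    by move=> /finj ->//; exact: mem_set.
  + move=> v /=; elim: v f tau tau' fP => [|i v IH] f tau tau' fP.
      by move=> _; exists [::] => //; exists 0%N; left.
    rewrite spine_words_rec; case: i => [|[|i]]//=.
      move=> /(IH (f \o S) (tau \o S) (tau' \o S) (fun n => fP n.+1))[u tu <-].
      by exists (0%N :: u) => //; rewrite spine_words_rec.
    have [[_ _ fsurj] _ _] := fP 0%N.
    by move=> /fsurj[u tu <-]; exists (1%N :: u) => //; rewrite spine_words_rec.
- move=> u; elim: u f tau tau' fP => [//|i u IH] f tau tau' fP.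
  rewrite spine_words_rec parent_cons; case: i => [|[|i]]//=.
  + case: u IH => [//|j u] IH tu.
    have E := IH (f \o S) (tau \o S) (tau' \o S) (fun n => fP n.+1) tu.
    change (0%N :: h (f \o S) (parent (j :: u)) =
      parent (0%N :: h (f \o S) (j :: u))).
    by rewrite E parent_cons; case: j {IH tu E} => [|[|j]].
  + case: u {IH} => [_|j u tu]; have [[fs finj fsurj] f0 fp] := fP 0%N.
      by rewrite parent_cons f0.
    change (1%N :: f 0%N (parent (j :: u)) = parent (1%N :: f 0%N (j :: u))).
    rewrite fp// [in RHS]parent_cons; case E : (f 0%N (j :: u)) => //.
    by have := ltree_iso_size (And3 fs finj fsurj) f0 fp tu; rewrite E.
Qed.

Definition spine_tree (tau : nat -> tree) : tree :=
  \pi_tree%qT (lspine (fun n => repr (tau n))).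

Lemma spine_tree_pi (tau : nat -> ltree) :
  spine_tree (fun n => \pi_tree%qT (tau n)) = \pi_tree%qT (lspine tau).
Proof. by apply/pi_ltreeP/lspine_iso => n; exact: iso_repr_pi. Qed.

Lemma binary_is_labelled_tree :
  is_labelled_tree [set u | all (fun i => i < 2)%N u].
Proof.
split=> //= [u|u].
- by rewrite -[in all _ u](cat_take_drop (size u).-1 u) all_cat => /andP[].
- by apply: (@sub_finite_set _ _ `I_2) => // i /=; rewrite all_rcons => /andP[].
Qed.

Definition complete_binary_tree : tree :=
  \pi_tree%qT (ltree_of binary_is_labelled_tree).

Section local_metric.
Context {R : realType}.
Local Open Scope ereal_scope.

Definition distinguishing_radii (t s : tree) : set (\bar R) :=
  [set k%:R%:E | k in [set k : nat | truncation k t <> truncation k s]].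

(* When the set of radii is empty, the infimum is +oo and the distance is 0. *)
Definition dloc (t s : tree) : R :=
  fine (expeR (- ereal_inf (distinguishing_radii t s))).

Lemma dlocE t s :
  (dloc t s)%:E = expeR (- ereal_inf (distinguishing_radii t s)).
Proof.
rewrite /dloc fineK// ge0_fin_numE ?expeR_ge0// lt_neqAle leey andbT expeR_eqy.
rewrite -ltey (@le_lt_trans _ _ 0)// oppe_le0.
by apply: le_ereal_inf_tmp => _ [k _ <-]; rewrite lee_fin.
Qed.

Lemma dloc_ge0 t s : (0 <= dloc t s)%R.
Proof. by rewrite -lee_fin dlocE expeR_ge0. Qed.

Lemma dloc_refl t : dloc t t = 0%R.
Proof.
apply: EFin_inj; rewrite dlocE.
rewrite (_ : distinguishing_radii t t = set0) ?ereal_inf0//.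
by rewrite -subset0 => _ [k /= + _].
Qed.

Lemma dloc_sym t s : dloc t s = dloc s t.
Proof.
apply: EFin_inj; rewrite !dlocE; congr (expeR (- ereal_inf _)).
by apply/seteqP; split=> _ [k /= h <-]; exists k => //=; exact: nesym.
Qed.

Lemma dloc_triangle s t r : (dloc t r <= dloc t s + dloc s r)%R.
Proof.
suff : (dloc t r <= dloc t s)%R \/ (dloc t r <= dloc s r)%R.
  by case=> /le_trans; apply; rewrite ?lerDl ?lerDr dloc_ge0.
suff : ereal_inf (distinguishing_radii t s) <= ereal_inf (distinguishing_radii t r)
    \/ ereal_inf (distinguishing_radii s r) <= ereal_inf (distinguishing_radii t r).
  by rewrite -!lee_fin !dlocE !lee_expeR !leeN2.
apply/orP; rewrite -ge_min; apply: le_ereal_inf_tmp => _ [k /= tr <-].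
rewrite ge_min; apply/orP.
have [tsk|tsk] := pselect (truncation k t = truncation k s).
- right; apply: ereal_inf_lbound; exists k => //= srk; apply: tr.
  by rewrite tsk.
- by left; apply: ereal_inf_lbound; exists k.
Qed.

End local_metric.

(* The alias carries the field of values of the metric. *)
Definition loctree (R : realType) : Type := tree.

Section local_topology.
Context {R : realType}.

HB.instance Definition _ := Pointed.on (loctree R).

Let ball (t : loctree R) (e : R) : set (loctree R) := [set s | dloc t s < e].
Let ent : set_system (loctree R * loctree R) := entourage_ ball.
Let nbhs (t : loctree R) : set_system (loctree R) := nbhs_ ent t.

HB.instance Definition _ := hasNbhs.Build (loctree R) nbhs.

Let ball_center t (e : R) : 0 < e -> ball t e t.
Proof. by move=> e0; rewrite /ball/= dloc_refl. Qed.

Let ball_sym t s (e : R) : ball t e s -> ball s e t.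
Proof. by rewrite /ball/= dloc_sym. Qed.

Let ball_triangle t s r e1 e2 : ball t e1 s -> ball s e2 r -> ball t (e1 + e2) r.
Proof.
by move=> ts sr; rewrite /ball/= (le_lt_trans (dloc_triangle s _ _))// ltrD.
Qed.

HB.instance Definition _ := @Nbhs_isPseudoMetric.Build R (loctree R)
  ent erefl ball ball_center ball_sym ball_triangle erefl.

End local_topology.

Section borel.
Context {R : realType}.

HB.instance Definition _ := Measurable.copy (loctree R)
  (g_sigma_algebraType (@open (loctree R))).

End borel.

Definition weak_cvg (R : realType)
    (mu : nat -> probability (loctree R) R) (nu : probability (loctree R) R) :=
  forall f : loctree R -> R, continuous f -> bounded_fun f ->
    (\int[mu n]_t (f t)%:E)%E @[n --> \oo] --> (\int[nu]_t (f t)%:E)%E.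

Section Gamma_function.
Context {R : realType}.
Notation mu := (@lebesgue_measure R).

Definition Gamma (x : R) : R :=
  \int[mu]_(t in `]0, +oo[) (t `^ (x - 1) * expR (- t)).

Let integrand (x t : R) : R := t `^ (x - 1) * expR (- t).

Let integrand_ge0 x t : 0 <= integrand x t.
Proof. by rewrite mulr_ge0 ?powR_ge0 ?expR_ge0. Qed.

Let measurable_integrand x (D : set R) : measurable_fun D (fun t => (integrand x t)%:E).
Proof.
apply/measurable_EFinP/measurable_funTS; apply: measurable_funM.
  exact: measurable_powR.
by apply: measurableT_comp; [exact: measurable_expR|exact: measurable_funN].
Qed.

Let measurable_pow x (D : set R) :
  measurable_fun D (fun t : R => (t `^ (x - 1))%:E).
Proof. by apply/measurable_EFinP/measurable_funTS; exact: measurable_powR. Qed.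

Let integral_powR (x a : R) : 0 < x -> 0 < a -> a < 1 ->
  (\int[mu]_(t in `[a, 1%R]) (t `^ (x - 1))%:E <= x^-1%:E)%E.
Proof.
move=> x0 a0 a1.
have dpow (y t : R) : 0 < t -> derivable (fun u : R => u `^ y) t 1.
  by move=> t0; apply: derivable_powR; rewrite in_itv/= t0.
have cpow (y t : R) : 0 < t -> {for t, continuous (fun u : R => u `^ y)}.
  move=> t0; apply: differentiable_continuous; apply/derivable1_diffP.
  exact: dpow.
rewrite (@continuous_FTC2 _ _ (fun t => x^-1 * t `^ x)) //.
- by rewrite powR1 mulr1 -EFinB lee_fin gerBl mulr_ge0 ?powR_ge0 ?invr_ge0 ?ltW.
- apply: continuous_in_subspaceT => t; rewrite inE/= in_itv/= => /andP[t0 _].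
  by apply: cpow; rewrite (lt_le_trans a0).
- split.
  + move=> t; rewrite in_itv/= => /andP[t0 _].
    by apply: derivableM => //; apply: dpow; rewrite (lt_trans a0).
  + apply: cvg_at_right_filter; apply: cvgM; first exact: cvg_cst.
    exact: cpow.
  + apply: cvg_at_left_filter; apply: cvgM; first exact: cvg_cst.
    exact: cpow.
- move=> t; rewrite in_itv/= => /andP[t0 _].
  have {}t0 : 0 < t by rewrite (lt_trans a0).
  rewrite derive1Ml; last exact: dpow.
  rewrite powR_derive1 ?in_itv/= ?t0//.
  by rewrite mulrA mulVf ?mul1r// gt_eqF.
Qed.

Let Gamma_near0 (x : R) : 0 < x ->
  (\int[mu]_(t in `]0%R, 1%R]) (integrand x t)%:E < +oo)%E.
Proof.
move=> x0; apply: (@le_lt_trans _ _ (x^-1)%:E); last exact: ltry.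
apply: (@le_trans _ _ (\int[mu]_(t in `]0%R, 1%R]) (t `^ (x - 1))%:E)%E).
  apply: ge0_le_integral => //=.
  - by move=> t _; rewrite lee_fin integrand_ge0.
  - exact: measurable_integrand.
  - exact: measurable_pow.
  - move=> t; rewrite in_itv/= => /andP[t0 _].
    by rewrite lee_fin ler_piMr ?powR_ge0// expR_le1 oppr_le0 ltW.
pose F (n : nat) : set R := `[n.+2%:R^-1, 1%R]%classic.
have -> : `]0%R, 1%R]%classic = \bigcup_n F n.
  apply/seteqP; split => [t|t [n _]]; rewrite /F/= !in_itv/=.
    move=> /andP[t0 t1]; exists (Num.truncn t^-1) => //=; rewrite in_itv/= t1 andbT.
    rewrite -[leRHS]invrK lef_pV2 ?posrE ?invr_gt0//.
    by rewrite (le_trans (ltW (truncnS_gt _)))// ler_nat.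
  by move=> /andP[+ ->]; rewrite andbT; apply: lt_le_trans; rewrite invr_gt0.
have cvI : (\int[mu]_(t in F n) (t `^ (x - 1))%:E)%E @[n --> \oo] -->
    (\int[mu]_(t in \bigcup_n F n) (t `^ (x - 1))%:E)%E.
  apply: ge0_nondecreasing_set_cvg_integral => //.
  - apply/nondecreasing_seqP => n; apply/subsetPset => t; rewrite /F/=.
    rewrite !in_itv/= => /andP[+ ->]; rewrite andbT; apply: le_trans.
    by rewrite lef_pV2 ?posrE// ler_nat.
  - by move=> n; exact: measurable_itv.
  - by move=> n; exact: measurable_pow.
  - by move=> n t _; rewrite lee_fin powR_ge0.
rewrite -(cvg_lim _ cvI)//; apply: lime_le.
  by apply/cvg_ex; eexists; exact: cvI.
apply: nearW => n; apply: integral_powR => //.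
by rewrite invf_lt1// ltr1n.
Qed.

Let Gamma_nearoo (x : R) :
  (\int[mu]_(t in `]1%R, +oo[) (integrand x t)%:E < +oo)%E.
Proof.
pose m := Num.truncn `|x|; pose C := 2 * 2 ^+ m.+1 * (m.+1)`!%:R : R.
have C0 : 0 <= C by rewrite !mulr_ge0 ?exprn_ge0.
pose p : R -> R := exponential_pdf 2^-1.
have p0 t : 0 <= p t by rewrite exponential_pdf_ge0// invr_ge0.
have mp D : measurable_fun D (fun t => (C * p t)%:E).
  apply/measurable_EFinP/measurable_funTS/measurable_funM => //.
  exact: measurable_exponential_pdf.
apply: (@le_lt_trans _ _ (\int[mu]_t (C * p t)%:E)%E); last first.
  under eq_integral do rewrite EFinM.
  rewrite ge0_integralZl//; last 2 first.
  - by apply/measurable_EFinP; exact: measurable_exponential_pdf.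
  - by move=> t _; rewrite lee_fin.
  by rewrite integral_exponential_pdf ?invr_gt0// mule1 ltry.
apply: (@le_trans _ _ (\int[mu]_(t in `]1%R, +oo[) (C * p t)%:E)%E); last first.
  apply: ge0_subset_integral => //; first exact: mp.
  by move=> t _; rewrite lee_fin mulr_ge0.
apply: ge0_le_integral => //=.
- by move=> t _; rewrite lee_fin integrand_ge0.
- exact: measurable_integrand.
- exact: mp.
- move=> t; rewrite in_itv/= andbT => t1; rewrite lee_fin.
  have t0 : 0 <= t by rewrite ltW// (lt_trans _ t1).
  rewrite /p exponential_pdfE// /C /integrand.
  have h1 : t `^ (x - 1) <= t ^+ m.+1.
    rewrite -powR_mulrn//; apply: ler_powR; first exact: ltW.
    rewrite (@le_trans _ _ x)// ?gerBl// (le_trans (ler_norm _))//.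
    by rewrite ltW// truncnS_gt.
  have h2 : t ^+ m.+1 <= 2 ^+ m.+1 * (m.+1)`!%:R * expR (t / 2).
    have t20 : 0 <= t / 2 by rewrite divr_ge0.
    have := @expR_ge1Dxn R _ m t20.
    move=> /(le_trans _) => /(_ ((t / 2) ^+ m.+1 / (m.+1)`!%:R)).
    rewrite lerDr ler01 => /(_ isT).
    rewrite ler_pdivrMr ?ltr0n ?fact_gt0// expr_div_n ler_pdivrMr ?exprn_gt0//.
    by rewrite -mulrA [X in _ <= _ * X]mulrC [leRHS]mulrC.
  apply: (@le_trans _ _ (2 ^+ m.+1 * (m.+1)`!%:R * expR (t / 2) * expR (- t))).
    by rewrite ler_wpM2r ?expR_ge0// (le_trans h1).
  rewrite -mulrA -expRD (_ : t / 2 - t = - 2^-1 * t); last first.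
    by rewrite {2}(splitr t) opprD addrA subrr add0r mulNr mulrC.
  rewrite [leRHS](_ : _ = 2 ^+ m.+1 * (m.+1)`!%:R * expR (- 2^-1 * t))//.
  by rewrite -!mulrA mulrCA; congr (_ * _); rewrite mulrCA; congr (_ * _);
    rewrite mulrA mulfV ?mul1r.
Qed.

Lemma Gamma_integral_lty (x : R) : 0 < x ->
  (\int[mu]_(t in `]0%R, +oo[) (t `^ (x - 1) * expR (- t))%:E < +oo)%E.
Proof.
move=> x0.
rewrite (_ : `]0, +oo[%classic = `]0, 1]%classic `|` `]1, +oo[%classic :> set R).
  rewrite ge0_integral_setU//; last 3 first.
  - exact: measurable_integrand.
  - by move=> t _; exact: integrand_ge0.
  - apply/disj_setPS => t [] /=; rewrite !in_itv/= => /andP[_ t1].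
    by rewrite andbT ltNge t1.
  - by rewrite lte_add_pinfty//; [exact: Gamma_near0|exact: Gamma_nearoo].
apply/seteqP; split => [t|t []] /=; rewrite !in_itv/= ?andbT.
- by move=> t0; case: (leP t 1) => t1; [left; rewrite t0|right].
- by move=> /andP[].
- exact: lt_trans.
Qed.

Lemma Gamma_gt0 (x : R) : 0 < x -> 0 < Gamma x.
Proof.
move=> x0; rewrite /Gamma /Rintegral fine_gt0// Gamma_integral_lty// andbT.
pose c : R := 2^-1 * expR (- 2).
apply: (@lt_le_trans _ _ (\int[mu]_(t in `[1%R, 2%R]) c%:E)%E).
  rewrite integral_cst//= lebesgue_measure_itv/= lte_fin ltr1n -EFinB.
  by rewrite -EFinM lte_fin mulr_gt0 ?mulr_gt0 ?expR_gt0// ?invr_gt0// subr_gt0 ltr1n.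
apply: (@le_trans _ _ (\int[mu]_(t in `[1%R, 2%R]) (integrand x t)%:E)%E).
  apply: ge0_le_integral => //=.
  - by move=> t _; rewrite lee_fin mulr_ge0 ?expR_ge0.
  - exact: measurable_integrand.
  - move=> t; rewrite in_itv/= => /andP[t1 t2]; rewrite lee_fin.
    rewrite ler_pM ?invr_ge0 ?expR_ge0//; last by rewrite ler_expR lerN2.
    have t0 : 0 < t by rewrite (lt_le_trans _ t1).
    rewrite (@le_trans _ _ (t `^ (- 1)))//; last first.
      by apply: ler_powR => //; rewrite lerBrDl subrr ltW.
    by rewrite powR_inv1 ?(ltW t0)// lef_pV2// posrE.
apply: ge0_subset_integral => //.
- exact: measurable_integrand.
- by move=> t _; rewrite lee_fin integrand_ge0.
- by move=> t /=; rewrite !in_itv/= andbT => /andP[t1 _]; rewrite (lt_le_trans _ t1).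
Qed.

End Gamma_function.

(* A family of mass functions q_n on partitions, encoded as sequences, where for
   n >= 2 all the mass is on the partitions (n - k, k) with 1 <= k <= n / 2. *)
Record split_law (R : realType) := SplitLaw {
  split_mass :> nat -> seq nat -> R;
  split_mass_ge0 : forall n l, 0 <= split_mass n l;
  split_mass_sum : forall n, (2 <= n)%N ->
    \sum_(1 <= k < n./2.+1) split_mass n [:: (n - k)%N; k] = 1
}.

Section beta_splitting.
Context {R : realType}.
Variable beta : R.

Definition beta_weight (n k : nat) : R :=
  (2 - (k.*2 == n)%:R)
    * (Gamma ((n - k)%:R + 1 + beta) / ((n - k)`!)%:R)
    * (Gamma (k%:R + 1 + beta) / (k`!)%:R).

Definition beta_normalisation (n : nat) : R :=
  \sum_(1 <= k < n./2.+1) beta_weight n k.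

Definition beta_mass (n : nat) (l : seq nat) : R :=
  match l with
  | [::] => (n == 1%N)%:R
  | [:: a; k] => if [&& (1 <= k)%N, (k.*2 <= n)%N & a == (n - k)%N]
                 then beta_weight n k / beta_normalisation n else 0
  | _ => 0
  end.

Hypothesis beta_gtN2 : -2 < beta.

Lemma Gamma_beta_gt0 k : (1 <= k)%N -> 0 < Gamma (k%:R + 1 + beta).
Proof.
move=> k1; apply: Gamma_gt0; rewrite -ltrBlDl sub0r (le_lt_trans _ beta_gtN2)//.
by rewrite lerN2 (natrD _ 1 1) lerD2r ler1n.
Qed.

Lemma beta_weight_gt0 n k : (1 <= k)%N -> (k.*2 <= n)%N -> 0 < beta_weight n k.
Proof.
move=> k1 kn.
have kn1 : (1 <= n - k)%N.
  by rewrite subn_gt0 (leq_trans _ kn)// -addnn -[ltnLHS]addn0 ltn_add2l.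
rewrite /beta_weight !mulr_gt0 ?Gamma_beta_gt0 ?invr_gt0 ?ltr0n ?fact_gt0//.
by rewrite subr_gt0; case: eqP => _; rewrite ?ltr0n ?ltr1n.
Qed.

Lemma beta_normalisation_gt0 n : (2 <= n)%N -> 0 < beta_normalisation n.
Proof.
move=> n2; rewrite /beta_normalisation big_ltn ?ltnS ?half_gt0//.
rewrite ltr_pwDl ?beta_weight_gt0// big_seq_cond.
apply: sumr_ge0 => k; rewrite andbT mem_index_iota ltnS geq_half_double.
by move=> /andP[k2 kn]; rewrite ltW// beta_weight_gt0// ltnW.
Qed.

Lemma beta_mass_ge0 n l : 0 <= beta_mass n l.
Proof.
case: l => [|a [|k []]]//=; case: ifP => // /and3P[k1 kn _].
rewrite ltW// divr_gt0 ?beta_weight_gt0// beta_normalisation_gt0//.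
by rewrite (leq_trans _ kn)// -[2%N]/(1.*2) leq_double.
Qed.

Lemma beta_mass_sum n : (2 <= n)%N ->
  \sum_(1 <= k < n./2.+1) beta_mass n [:: (n - k)%N; k] = 1.
Proof.
move=> n2.
transitivity (\sum_(1 <= k < n./2.+1) beta_weight n k / beta_normalisation n).
  apply: eq_big_seq => k; rewrite mem_index_iota ltnS geq_half_double => /andP[k1 kn].
  by rewrite /beta_mass k1 kn eqxx.
rewrite -mulr_suml divff// gt_eqF//.
exact: beta_normalisation_gt0.
Qed.

Definition beta_split : split_law R := SplitLaw beta_mass_ge0 beta_mass_sum.

End beta_splitting.

Section markov_branching.
Context {R : realType}.
Variable q : split_law R.

(* The law of T_n has finite support and is built as a list of weighted
   outcomes, see [outcomesE].  The first argument bounds the depth of the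
   recursion.  The value at n = 0 is a convention. *)
Fixpoint outcomes_rec (d n : nat) : seq (R * loctree R) :=
  match d with
  | 0%N => [:: (1, leaf : loctree R)]
  | d'.+1 =>
    if (n <= 1)%N then [:: (1, leaf : loctree R)] else
    flatten [seq [seq (q n [:: (n - k)%N; k] * x.1 * y.1,
                       join x.2 y.2 : loctree R)
                 | x <- outcomes_rec d' (n - k), y <- outcomes_rec d' k]
            | k <- index_iota 1 n./2.+1]
  end.

Definition outcomes (n : nat) := outcomes_rec n n.

Lemma outcomes_rec_stable d e n : (n <= d)%N -> (n <= e)%N ->
  outcomes_rec d n = outcomes_rec e n.
Proof.
elim: d e n => [|d IH] [|e] n.
- by [].
- by rewrite leqn0 => /eqP->.
- by move=> _; rewrite leqn0 => /eqP->.
- move=> nd ne /=; case: leqP => // n1; congr flatten.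
  apply/eq_in_map => k; rewrite mem_index_iota ltnS geq_half_double => /andP[k1 kn].
  have n0 : (0 < n)%N by rewrite ltnW.
  have nk m : (n <= m.+1)%N -> (n - k <= m)%N.
    by move=> nm; rewrite leq_subLR (leq_trans nm)// -add1n leq_add2r.
  have kk m : (n <= m.+1)%N -> (k <= m)%N.
    move=> nm; rewrite -ltnS (leq_trans _ nm)// (leq_trans _ kn)//.
    by rewrite -addnn -[ltnLHS]addn0 ltn_add2l.
  by rewrite (IH e (n - k)%N) ?nk// (IH e k) ?kk.
Qed.

Lemma outcomes1 : outcomes 1 = [:: (1, leaf : loctree R)].
Proof. by []. Qed.

Lemma outcomesE n : (2 <= n)%N -> outcomes n =
  flatten [seq [seq (q n [:: (n - k)%N; k] * x.1 * y.1,
                     join x.2 y.2 : loctree R)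
               | x <- outcomes (n - k), y <- outcomes k]
          | k <- index_iota 1 n./2.+1].
Proof.
case: n => // n n2; rewrite [LHS](_ : _ = flatten
  [seq [seq (q n.+1 [:: (n.+1 - k)%N; k] * x.1 * y.1,
             join x.2 y.2 : loctree R)
       | x <- outcomes_rec n (n.+1 - k), y <- outcomes_rec n k]
  | k <- index_iota 1 n.+1./2.+1]); last first.
  by rewrite /outcomes [LHS]/= leqNgt n2.
congr flatten; apply/eq_in_map => k; rewrite mem_index_iota ltnS geq_half_double => /andP[k1 kn].
have kk : (k <= n)%N.
  rewrite -ltnS (leq_trans _ kn)//.
  by rewrite -addnn -[ltnLHS]addn0 ltn_add2l.
have nk : (n.+1 - k <= n)%N by rewrite leq_subLR -add1n leq_add2r.
by rewrite /outcomes (@outcomes_rec_stable _ (n.+1 - k) (n.+1 - k))// (@outcomes_rec_stable _ k k).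
Qed.

Lemma outcomes_ge0 n x : x \in outcomes n -> 0 <= x.1.
Proof.
rewrite /outcomes; move: {1}n => d; elim: d n x => [|d IH] n x /=.
  by rewrite inE => /eqP->.
case: ifP => _; first by rewrite inE => /eqP->.
move=> /flattenP[_ /mapP[k _ ->]] /allpairsP[[y z]] [/= yk zk ->].
by rewrite !mulr_ge0 ?split_mass_ge0 ?(IH _ _ yk) ?(IH _ _ zk).
Qed.

Lemma outcomes_sum n : \sum_(x <- outcomes n) x.1 = 1.
Proof.
rewrite /outcomes; move: {1}n => d; elim: d n => [|d IH] n /=; first by rewrite big_seq1.
case: leqP => [_|n2]; first by rewrite big_seq1.
rewrite big_flatten big_map -[RHS](split_mass_sum q n2).
apply: eq_bigr => k _; rewrite big_allpairs_dep/=.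
transitivity (\sum_(x <- outcomes_rec d (n - k))
    q n [:: (n - k)%N; k] * x.1 * \sum_(y <- outcomes_rec d k) y.1).
  by apply: eq_bigr => x _; rewrite mulr_sumr.
by rewrite IH; under eq_bigr do rewrite mulr1; rewrite -mulr_sumr IH mulr1.
Qed.

Definition MB (n : nat) (A : set (loctree R)) : \bar R :=
  (\sum_(x <- outcomes n) x.1%:E * \d_x.2 A)%E.

Let MB0 n : MB n set0 = 0%E.
Proof. by rewrite /MB big1// => x _; rewrite measure0 mule0. Qed.

Let MB_ge0 n A : (0 <= MB n A)%E.
Proof.
rewrite /MB big_seq; apply: sume_ge0 => x xn.
by rewrite mule_ge0 ?lee_fin ?(outcomes_ge0 xn).
Qed.

Let MB_sigma_additive n : semi_sigma_additive (MB n).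
Proof.
pose w i : {nonneg R} := NngNum (normr_ge0 (nth (0, leaf : loctree R) (outcomes n) i).1).
pose m i := mscale (w i) (\d_(nth (0, leaf : loctree R) (outcomes n) i).2).
have -> : MB n = msum m (size (outcomes n)).
  apply/funext => A; rewrite /MB /msum (big_nth (0, leaf : loctree R)) big_mkord.
  apply: eq_bigr => i _.
  have /ger0_norm h := outcomes_ge0 (mem_nth (0, leaf : loctree R) (ltn_ord i)).
  by rewrite -[in LHS]h.
exact: measure_semi_sigma_additive.
Qed.

HB.instance Definition _ n := isMeasure.Build _ _ _ (MB n)
  (MB0 n) (@MB_ge0 n) (@MB_sigma_additive n).

Let MB_setT n : MB n setT = 1%E.
Proof.
rewrite /MB; under eq_bigr do rewrite diracT mule1.
by rewrite sumEFin outcomes_sum.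
Qed.

HB.instance Definition _ n := Measure_isProbability.Build _ _ _ (MB n)
  (MB_setT n).

End markov_branching.

(* [None] stands for the infinite part. *)
Definition ext_ge (a b : option nat) : bool :=
  match a, b with
  | None, _ => true
  | Some m, Some n => (n <= m)%N
  | Some _, None => false
  end.

Definition is_infinite_partition (l : seq (option nat)) : bool :=
  [&& sorted ext_ge l, all (fun a => a != Some 0%N) l & None \in l].

Definition infinite_partition := {l : seq (option nat) | is_infinite_partition l}.

Definition partition_length (l : infinite_partition) : nat := size (val l).

Definition infinite_multiplicity (l : infinite_partition) : nat :=
  count_mem None (val l).

Lemma infinite_pair_subproof (k : nat) :
  is_infinite_partition [:: None; Some k.+1].
Proof. by []. Qed.

(* The partition (oo, k + 1). *)
Definition infinite_pair (k : nat) : infinite_partition :=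
  exist _ [:: None; Some k.+1] (infinite_pair_subproof k).

Definition beta_geometric (R : realType) (theta : R) (n : nat) : R :=
  theta * Gamma (n%:R + 1 - theta) / (Gamma (1 - theta) * ((n.+1)`!)%:R).

Definition beta_infinite_mass (R : realType) (beta : R)
    (l : infinite_partition) : R :=
  if (partition_length l == 2) && (infinite_multiplicity l == 1) then
    match nth None (val l) 1 with
    | Some k => beta_geometric (-1 - beta) k.-1
    | None => 0
    end
  else 0.

Definition mutually_independent (R : realType) (d d' : measure_display)
    (Omega : measurableType d) (T : measurableType d')
    (P : probability Omega R) (X : nat -> Omega -> T) : Prop :=
  forall (J : seq nat) (C : nat -> set T), uniq J ->
    (forall j, measurable (C j)) ->
    (P (\bigcap_(j in [set` J]) (X j @^-1` C j)) =
     \prod_(j <- J) P (X j @^-1` C j))%E.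

(* [nu] is the law of the tree with an infinite spine built from i.i.d. pairs
   (K n, tau n).  The joint law of each pair is given by the mass function of
   K n and the conditional law of tau n given K n. *)
Definition is_MB_infinite_law (R : realType) (q : split_law R)
    (qoo : infinite_partition -> R) (nu : probability (loctree R) R) : Prop :=
  exists (d : measure_display) (Omega : measurableType d)
    (P : probability Omega R) (K : nat -> Omega -> nat)
    (tau : nat -> Omega -> loctree R),
  [/\ (forall n, measurable_fun setT (K n) /\ measurable_fun setT (tau n)),
      mutually_independent P (fun n w => (K n w, tau n w)),
      (forall n k, P (K n @^-1` [set k.+1]) = (qoo (infinite_pair k))%:E),
      (forall n k (A : set (loctree R)), measurable A ->
         P (K n @^-1` [set k.+1] `&` tau n @^-1` A) =
         (P (K n @^-1` [set k.+1]) * MB q k.+1 A)%E) &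
      (forall A : set (loctree R), measurable A ->
         nu A = P [set w | A (spine_tree (fun n => tau n w))])].

(* Main.v *)
Require Import Defs.
From mathcomp Require Import all_boot all_order all_algebra.
From mathcomp Require Import generic_quotient.
From mathcomp Require Import all_classical all_reals all_analysis.
From mathcomp Require Import measurable_realfun.
From mathcomp Require Import lra ring zify.

Set Implicit Arguments.
Unset Strict Implicit.
Unset Printing Implicit Defensive.

Import Order.TTheory GRing.Theory Num.Theory.
Import numFieldNormedType.Exports.

Local Open Scope classical_set_scope.
Local Open Scope ring_scope.

(** Write w m = Gamma (m + 1 + beta) / m!, so that the split of n into (n - k, k)
    has weight 2 w (n - k) w k, halved when n = 2 k; let Z n be the total weight.  Euler's
    recursion for Gamma gives (m + 1) w (m + 1) = (m + 1 + beta) w m, and all that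
    is needed of the split law follows from it.  Since w (n - k) / w n tends to 1
    for fixed k, the probability of the split (n - k, k) behaves like
    2 w k / (Z n / w n).
    - If beta >= -1 then m * w m is nondecreasing, the series of the w k diverges
      like the harmonic series, Z n / w n tends to infinity, and every fixed split
      has vanishing probability ([beta_mass_cvg0]).
    - If beta < -1 the recursion makes the partial sums of w telescope to
      w 1 / (-1 - beta), and Z n / w n tends to twice their limit, because large
      parts k <= n / 2 carry a negligible share of the weight.  The split probabilities then tend to
      a probability on the positive integers, which is the beta geometric one
      ([beta_mass_cvg], [beta_infinite_mass_sum]).

    Passing from the splits to the trees is a matter of lower bounds.  It suffices
    ([weak_cvg_determined]) to bound from below, in the limit, the expectations of
    nonnegative functions g of a ball of fixed radius around the root, because upper
    bounds come from applying the same to B - g.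

    When small splits disappear, both subtrees of the root become large, and
    induction on the radius shows that the ball around the root is that of the
    complete binary tree with probability tending to 1 ([binary_tree_limit]).

    When the splits converge, iterate the recursion r times along the larger part,
    keeping only smaller parts of size at most M.  This leaves a fixed finite sum
    whose limit is [spine_functional]: it bounds from below the limit of the
    expectation of g under MB n ([expectation_lower_bound]) and the expectation of g
    under the law of the infinite tree ([spine_functional_le_integral]).  The mass
    lost by the restriction to parts of size at most M tends to 0 when M grows,
    so the two expectations agree in the limit ([spine_tree_limit]). *)

(** * Euler's recursion for the Gamma function *)

Section Gamma_recursion.
Context {R : realType}.
Notation mu := (@lebesgue_measure R).

Let gdens (x t : R) : R := t `^ (x - 1) * expR (- t).

Let gdens_ge0 x t : 0 <= gdens x t.
Proof. by rewrite mulr_ge0 ?powR_ge0 ?expR_ge0. Qed.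

Let measurable_gdens x (D : set R) : measurable_fun D (EFin \o gdens x).
Proof.
apply/measurable_EFinP/measurable_funTS; apply: measurable_funM.
  exact: measurable_powR.
by apply: measurableT_comp; [exact: measurable_expR|exact: measurable_funN].
Qed.

Let integrable_gdens (x : R) : 0 < x -> mu.-integrable `]0, +oo[ (EFin \o gdens x).
Proof.
move=> x0; apply/integrableP; split; first exact: measurable_gdens.
under eq_integral do rewrite gee0_abs ?lee_fin ?gdens_ge0//.
exact: Gamma_integral_lty.
Qed.

(** Truncating the integral to compact intervals avoids the singularity of the
    integrand at 0 when the argument is less than 1. *)
Let box (n : nat) : set R := `[n.+2%:R^-1, n.+2%:R].

Let box_sub n : box n `<=` `]0, +oo[.
Proof.
move=> t; rewrite /box/= !in_itv/= andbT => /andP[+ _].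
by apply: lt_le_trans; rewrite invr_gt0.
Qed.

Let Gamma_cvg_box (x : R) : 0 < x ->
  \int[mu]_(t in box n) gdens x t @[n --> \oo] --> Gamma x.
Proof.
move=> x0.
have -> : Gamma x = fine (\int[mu]_(t in \bigcup_n box n) (gdens x t)%:E)%E.
  rewrite /Gamma /Rintegral; congr (fine (integral _ _ _)).
  apply/seteqP; split => [t|t [n _ /box_sub]//].
  rewrite /= in_itv/= andbT => t0.
  exists (maxn (Num.truncn t) (Num.truncn t^-1)) => //.
  have le_max m (y : R) : (Num.truncn y <= m)%N -> y <= m.+2%:R.
    move=> ym; rewrite (le_trans (ltW (truncnS_gt _)))// ler_nat.
    by rewrite (leq_trans (_ : _ <= m.+1)%N).
  rewrite /box/= in_itv/= le_max ?leq_maxl// andbT.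
  by rewrite -[leRHS]invrK lef_pV2 ?posrE ?invr_gt0// le_max ?leq_maxr.
apply: fine_cvg; rewrite fineK; last first.
  have mb : measurable (\bigcup_n box n).
    by apply: bigcup_measurable => n _; exact: measurable_itv.
  apply: integrable_fin_num => //; apply: integrableS (integrable_gdens x0) => //.
  by move=> t [n _ /box_sub].
apply: ge0_nondecreasing_set_cvg_integral => //.
- apply/nondecreasing_seqP => n; apply/subsetPset => t; rewrite /box/= !in_itv/=.
  move=> /andP[nt tn]; apply/andP; split.
    by apply: le_trans nt; rewrite lef_pV2 ?posrE// ler_nat.
  by rewrite (le_trans tn)// ler_nat.
- by move=> n; exact: measurable_itv.
- by move=> n; exact: measurable_gdens.
- by move=> n t _; rewrite lee_fin.
Qed.

Let boundary_cvgy (x : R) : 0 < x ->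
  (n.+2%:R : R) `^ x * expR (- n.+2%:R) @[n --> \oo] --> (0 : R).
Proof.
move=> x0; pose m := Num.truncn x.
apply: (@squeeze_cvgr _ _ _ _ (cst 0) (fun n => (m.+2)`!%:R * (n.+2%:R : R)^-1)).
- near=> n; rewrite mulr_ge0 ?powR_ge0 ?expR_ge0//=.
  set t : R := n.+2%:R; have t0 : 0 < t by rewrite ltr0n.
  apply: (@le_trans _ _ (t ^+ m.+1 * expR (- t))).
    rewrite ler_wpM2r ?expR_ge0// -powR_mulrn ?(ltW t0)//.
    by apply: ler_powR; [rewrite ler1n|rewrite ltW// truncnS_gt].
  rewrite expRN ler_pdivrMr ?expR_gt0// mulrAC ler_pdivlMr// -exprSr.
  (* One power more than needed in the exponential series leaves a factor 1 / t. *)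
  have := @expR_ge1Dxn R t m.+1 (ltW t0).
  move=> /(le_trans _) => /(_ (t ^+ m.+2 / (m.+2)`!%:R)).
  by rewrite lerDr ler01 ler_pdivrMr ?ltr0n ?fact_gt0// mulrC; apply.
- exact: cvg_cst.
- rewrite -[X in _ --> X](mulr0 (m.+2)`!%:R); apply: cvgMr.
  by have := @cvg_harmonic R; rewrite -cvg_shiftS.
Unshelve. all: by end_near. Qed.

Let boundary_cvg0 (x : R) : 0 < x ->
  (n.+2%:R^-1 : R) `^ x * expR (- n.+2%:R^-1) @[n --> \oo] --> (0 : R).
Proof.
move=> x0.
have h : (n.+2%:R : R)^-1 @[n --> \oo] --> (0:R).
  by have := @cvg_harmonic R; rewrite -cvg_shiftS.
apply: (@squeeze_cvgr _ _ _ _ (cst 0) (fun n => (n.+2%:R^-1 : R) `^ x)).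
- near=> n; rewrite mulr_ge0 ?powR_ge0 ?expR_ge0//=.
  by rewrite ler_piMr ?powR_ge0// expR_le1 oppr_le0 invr_ge0.
- exact: cvg_cst.
- apply: (cvg_comp _ _ _ (powR_cvg0 x0)).
  move=> A [e /= e0 eA]; near=> n; apply: eA => /=; last by rewrite invr_gt0.
  by near: n; move: h => /cvgrPdist_lt /(_ e e0).
Unshelve. all: by end_near. Qed.

(** The integrand is the derivative of t `^ x * expR (- t), so the integral
    over a compact interval is a boundary term. *)
Let by_parts_box (x : R) n : 0 < x ->
  x * \int[mu]_(t in box n) gdens x t - \int[mu]_(t in box n) gdens (x + 1) t =
  (n.+2%:R : R) `^ x * expR (- n.+2%:R)
    - (n.+2%:R^-1 : R) `^ x * expR (- n.+2%:R^-1).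
Proof.
move=> x0.
have mb : measurable (box n) by exact: measurable_itv.
have ib (y : R) : 0 < y -> mu.-integrable (box n) (EFin \o gdens y).
  move=> y0; apply: integrableS (integrable_gdens y0); first exact: measurable_itv.
    exact: measurable_itv.
  exact: box_sub.
have x10 : 0 < x + 1 by rewrite addr_gt0.
rewrite -RintegralZl ?ib// -RintegralB//; last 2 first.
- have : mu.-integrable (box n) (fun t => x%:E * (gdens x t)%:E)%E.
    by apply: integrableZl; [exact: measurable_itv|exact: ib].
  by apply: eq_integrable => // t _ /=; rewrite EFinM.
- exact: ib.
have dpow (y t : R) : 0 < t -> derivable (fun u : R => u `^ y) t 1.
  by move=> t0; apply: derivable_powR; rewrite in_itv/= t0.
have cpow (y t : R) : 0 < t -> {for t, continuous (fun u : R => u `^ y)}.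
  move=> t0; apply: differentiable_continuous; apply/derivable1_diffP.
  exact: dpow.
have cexp (t : R) : {for t, continuous (fun u : R => expR (- u))}.
  by apply: continuous_comp; [exact: opp_continuous|exact: continuous_expR].
have cdiff (t : R) : `]0, +oo[%classic t ->
    {for t, continuous (fun u : R => x * gdens x u - gdens (x + 1) u)}.
  rewrite /= in_itv/= andbT => t0.
  apply: cvgB; last by apply: cvgM; [exact: cpow|exact: cexp].
  by apply: cvgMr; apply: cvgM; [exact: cpow|exact: cexp].
rewrite /Rintegral (@continuous_FTC2 _ _ (fun t => t `^ x * expR (- t))) //.
- by rewrite (@lt_trans _ _ 1)// ?invf_lt1 ?ltr1n.
- by apply: continuous_in_subspaceT => t; rewrite inE => /box_sub; exact: cdiff.
- split.
  + move=> t; rewrite in_itv/= => /andP[t0 _].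
    by apply: derivableM => //; apply: dpow; rewrite (lt_trans _ t0)// invr_gt0.
  + apply: cvg_at_right_filter; apply: cvgM; last exact: cexp.
    by apply: cpow; rewrite invr_gt0.
  + by apply: cvg_at_left_filter; apply: cvgM; [exact: cpow|exact: cexp].
- move=> t; rewrite in_itv/= => /andP[t0 _].
  have {}t0 : 0 < t by rewrite (lt_trans _ t0)// invr_gt0.
  have Dexp : is_derive t 1 (fun u : R => expR (- u)) (- expR (- t)).
    by rewrite -[- expR _]mulrN1; apply: is_derive1_comp.
  have Dpow := is_derive1_powR x t0.
  rewrite derive1E (@derive_val _ _ _ _ _ _ _ (is_deriveM Dpow Dexp)).
  rewrite /gdens addrK /GRing.scale/=; ring.
Qed.

Lemma GammaS (x : R) : 0 < x -> Gamma (x + 1) = x * Gamma x.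
Proof.
move=> x0; apply/esym/eqP; rewrite -subr_eq0; apply/eqP.
have x10 : 0 < x + 1 by rewrite addr_gt0.
have lim_diff : x * \int[mu]_(t in box n) gdens x t
    - \int[mu]_(t in box n) gdens (x + 1) t @[n --> \oo]
    --> x * Gamma x - Gamma (x + 1).
  by apply: cvgB; [apply: cvgMr|]; exact: Gamma_cvg_box.
move: lim_diff; rewrite (eq_cvg _ _ (fun n => by_parts_box n x0)) => lim_diff.
apply: (cvg_unique (@norm_hausdorff _ _) lim_diff).
rewrite -(subr0 0); apply: cvgB; [exact: boundary_cvgy|exact: boundary_cvg0].
Qed.

End Gamma_recursion.

(** * The split probabilities *)

Section part_weights.
Context {R : realType}.
Variable beta : R.

Definition part_weight (m : nat) : R := Gamma (m%:R + 1 + beta) / m`!%:R.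
Local Notation w := part_weight.

Lemma beta_weightE n k : beta_weight beta n k = (2 - (k.*2 == n)%:R) * w (n - k) * w k.
Proof. by []. Qed.

Hypothesis beta_gtN2 : -2 < beta.

Lemma part_weight_gt0 m : (1 <= m)%N -> 0 < w m.
Proof. by move=> m1; rewrite divr_gt0 ?Gamma_beta_gt0// ltr0n fact_gt0. Qed.

(** With positivity, this consequence of [GammaS] is all that the asymptotics of
    the split law rest on. *)
Lemma part_weightS m : (1 <= m)%N -> m.+1%:R * w m.+1 = (m.+1%:R + beta) * w m.
Proof.
move=> m1; rewrite /part_weight -[m.+1%:R + 1 + beta]addrAC GammaS; last first.
  by have := ler1n R m; rewrite m1 -natr1; move: beta_gtN2; lra.
rewrite factS natrM invfM -natr1; field.
by rewrite !pnatr_eq0 -lt0n fact_gt0 natr1 pnatr_eq0.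
Qed.

Lemma part_weight_ratio_cvg k : w (n - k) / w n @[n --> \oo] --> (1 : R).
Proof.
have ratioS : w n / w n.+1 @[n --> \oo] --> (1 : R).
  rewrite -[X in _ --> X]invr1.
  have -> : (fun n => w n / w n.+1) = (fun n => (w n.+1 / w n)^-1).
    by apply/funext => n; rewrite [RHS]invf_div.
  apply: (@cvgV _ _ \oo _ (fun n => w n.+1 / w n)); first exact: oner_neq0.
  have : 1 + beta * harmonic n @[n --> \oo] --> 1 + beta * (0:R).
    by apply: cvgD; [exact: cvg_cst|apply: cvgMr; exact: cvg_harmonic].
  rewrite mulr0 addr0; apply: cvg_trans; apply: near_eq_cvg; near=> n.
  have n1 : (1 <= n)%N by near: n; exact: nbhs_infty_ge.
  have wn0 := lt0r_neq0 (part_weight_gt0 n1).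
  have -> : w n.+1 = (n.+1%:R + beta) * w n / n.+1%:R.
    by rewrite -part_weightS// mulrAC divff ?mul1r// pnatr_eq0.
  by rewrite /=; field; rewrite wn0 nat1r pnatr_eq0.
elim: k => [|k IH].
  have : (fun=> 1 : R) @ \oo --> (1 : R) by exact: cvg_cst.
  apply: cvg_trans; apply: near_eq_cvg; near=> n.
  rewrite subn0 divff// lt0r_neq0// part_weight_gt0//.
  by near: n; exact: nbhs_infty_ge.
have : w (n - k.+1) / w (n - k.+1).+1 * (w (n - k) / w n) @[n --> \oo] --> (1 * 1 : R).
  by apply: cvgM IH; exact: (cvg_comp _ _ (@cvg_subnr k.+1) ratioS).
rewrite mulr1; apply: cvg_trans; apply: near_eq_cvg; near=> n.
have kn : (k.+1 < n)%N by near: n; exact: nbhs_infty_gt.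
rewrite /= -subSn 1?ltnW// subSS mulrA mulfVK// lt0r_neq0// part_weight_gt0//.
by rewrite subn_gt0 ltnW.
Unshelve. all: by end_near. Qed.

(** The strict inequality keeps the first sum away from the balanced split, whose
    weight is not doubled. *)
Lemma beta_normalisation_split M n : (M.*2 < n)%N ->
  beta_normalisation beta n = 2 * \sum_(1 <= j < M.+1) w j * w (n - j)
    + \sum_(M.+1 <= j < n./2.+1) beta_weight beta n j.
Proof.
move=> Mn; rewrite /beta_normalisation (@big_cat_nat _ _ _ M.+1)//=; last first.
  by rewrite ltnS geq_half_double ltnW.
congr (_ + _); rewrite mulr_sumr; apply: eq_big_nat => j /andP[j1 jM].
rewrite beta_weightE ltn_eqF ?subr0 1?mulrAC ?mulrA//.
by rewrite (leq_ltn_trans _ Mn)// leq_double.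
Qed.

Lemma beta_massE n k : (1 <= k)%N -> (k.*2 < n)%N ->
  beta_mass beta n [:: (n - k)%N; k] = 2 * w k * (w (n - k) / w n)
    / (beta_normalisation beta n / w n).
Proof.
move=> k1 kn; rewrite /beta_mass k1 (ltnW kn) eqxx/= beta_weightE ltn_eqF// subr0.
have n2 : (2 <= n)%N by lia.
have wn0 : w n != 0 by rewrite lt0r_neq0// part_weight_gt0// ltnW.
have Z0 : beta_normalisation beta n != 0.
  by rewrite lt0r_neq0// beta_normalisation_gt0.
by field; rewrite Z0 wn0.
Qed.

Lemma normalised_weight_gt0 n : (2 <= n)%N -> 0 < beta_normalisation beta n / w n.
Proof.
move=> n2; rewrite divr_gt0 ?beta_normalisation_gt0// part_weight_gt0//.
exact: ltnW.
Qed.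

Lemma head_sum_cvg M :
  \sum_(1 <= j < M.+1) w j * (w (n - j) / w n) @[n --> \oo]
    --> \sum_(1 <= j < M.+1) w j.
Proof.
rewrite -[X in _ --> X](_ : \sum_(1 <= j < M.+1) w j * 1 = _); last first.
  by apply: eq_bigr => j _; rewrite mulr1.
apply: cvg_big => [|j _]; first exact: add_continuous.
by apply: cvgMr; exact: part_weight_ratio_cvg.
Qed.

End part_weights.

Lemma harmonic_sum_unbounded (R : realType) (A : R) :
  exists M, A <= \sum_(1 <= j < M.+1) j%:R^-1.
Proof.
apply: contrapT => /forallNP noM; apply: (@dvg_harmonic R).
apply: nondecreasing_is_cvgn.
  apply/nondecreasing_seqP => n; rewrite /series/= big_nat_recr//= lerDl.
  by rewrite invr_ge0.
exists A => _ [n _ <-]; rewrite /series/=.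
have /negP := noM n; rewrite -ltNge => /ltW.
by rewrite big_add1/=.
Qed.

Section divergent_case.
Context {R : realType}.
Variable beta : R.
Hypotheses (beta_gtN2 : -2 < beta) (beta_geN1 : -1 <= beta).
Local Notation w := (part_weight beta).

(** For beta >= -1 the recursion makes m * w m nondecreasing, so w dominates the
    harmonic sequence. *)
Lemma part_weight_sum_unbounded A : exists M, A <= \sum_(1 <= j < M.+1) w j.
Proof.
have w1 : 0 < w 1 by exact: part_weight_gt0.
have w_ge j : (1 <= j)%N -> w 1 * j%:R^-1 <= w j.
  move=> j1; rewrite ler_pdivrMr ?ltr0n// mulrC; elim: j j1 => // -[|j] IH _.
    by rewrite mul1r.
  rewrite (le_trans (IH isT))// [leRHS]part_weightS// ler_wpM2r//.
    by rewrite ltW// part_weight_gt0.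
  by rewrite -natr1; move: beta_geN1; lra.
have [M hM] := harmonic_sum_unbounded (A / w 1); exists M.
rewrite ler_pdivrMr// mulrC in hM.
apply: (le_trans hM); rewrite mulr_sumr; apply: ler_sum_nat => j /andP[j1 _].
exact: w_ge.
Qed.

Lemma beta_normalisation_ratio_cvgy : beta_normalisation beta n / w n @[n --> \oo] --> +oo.
Proof.
apply/cvgryPge => A; have [M hM] := part_weight_sum_unbounded (A + 1).
have AM : A < \sum_(1 <= j < M.+1) w j by rewrite (lt_le_trans _ hM)// ltrDl.
near=> n.
have Mn : (M.*2 < n)%N by near: n; exact: nbhs_infty_gt.
have n1 : (1 <= n)%N by rewrite (leq_trans _ Mn).
apply: (@le_trans _ _ (\sum_(1 <= j < M.+1) w j * (w (n - j) / w n))).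
  by near: n; apply: cvgr_ge AM; exact: head_sum_cvg.
rewrite (beta_normalisation_split _ Mn) ler_pdivlMr ?part_weight_gt0// mulr_suml.
have -> : \sum_(1 <= j < M.+1) w j * (w (n - j) / w n) * w n =
    \sum_(1 <= j < M.+1) w j * w (n - j).
  by apply: eq_bigr => j _; rewrite mulrA mulfVK// lt0r_neq0// part_weight_gt0.
rewrite -[leLHS]addr0 lerD//.
  rewrite ler_peMl ?ler1n// big_nat sumr_ge0// => j /andP[j1 jM].
  by rewrite mulr_ge0// ltW// part_weight_gt0//; lia.
rewrite big_nat sumr_ge0// => j /andP[Mj jn].
by rewrite ltW// beta_weight_gt0//; lia.
Unshelve. all: by end_near. Qed.

Lemma beta_mass_cvg0 k : (1 <= k)%N ->
  beta_mass beta n [:: (n - k)%N; k] @[n --> \oo] --> (0 : R).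
Proof.
move=> k1.
have : 2 * w k * (w (n - k) / w n) * (beta_normalisation beta n / w n)^-1 @[n --> \oo]
    --> (2 * w k * 1 * 0 : R).
  apply: cvgM; first by apply: cvgMr; exact: part_weight_ratio_cvg.
  apply/gtr0_cvgV0; last exact: beta_normalisation_ratio_cvgy.
  near=> n; apply: normalised_weight_gt0 => //.
  by near: n; exact: nbhs_infty_ge.
rewrite mulr0; apply: cvg_trans; apply: near_eq_cvg; near=> n.
rewrite beta_massE//; near: n; exact: nbhs_infty_gt.
Unshelve. all: by end_near. Qed.

End divergent_case.

Section convergent_case.
Context {R : realType}.
Variable beta : R.
Hypotheses (beta_gtN2 : -2 < beta) (beta_ltN1 : beta < -1).
Local Notation w := (part_weight beta).
Let theta : R := -1 - beta.

Let theta_gt0 : 0 < theta. Proof. by rewrite /theta; move: beta_ltN1; lra. Qed.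

(** The increments of m * w m are (1 + beta) * w m, so the sum telescopes. *)
Lemma part_weight_sumE M :
  theta * \sum_(1 <= j < M.+1) w j = w 1 - M.+1%:R * w M.+1.
Proof.
pose v j := j%:R * w j.
have -> : w 1 - M.+1%:R * w M.+1 = - \sum_(1 <= j < M.+1) (v j.+1 - v j).
  by rewrite telescope_sumr// opprB /v mul1r.
rewrite -sumrN mulr_sumr /v.
apply: eq_big_nat => j /andP[j1 _]; rewrite part_weightS// -natr1 /theta; ring.
Qed.

(** A positive lower bound on m * w m, which is nonincreasing, would make the
    bounded sums of w dominate the harmonic ones. *)
Lemma part_weight_tail_cvg0 : n.+1%:R * w n.+1 @[n --> \oo] --> (0 : R).
Proof.
pose v n := n.+1%:R * w n.+1.
have v_ge0 n : 0 <= v n by rewrite mulr_ge0// ltW// part_weight_gt0.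
have v_ni : nonincreasing_seq v.
  apply/nonincreasing_seqP => n; rewrite /v part_weightS//.
  rewrite ler_wpM2r ?(ltW (part_weight_gt0 _ _))//.
  by rewrite -natr1; move: beta_ltN1; lra.
apply/cvgrPdist_lt => e e0.
suff [m vm] : exists m, v m < e.
  near=> n; rewrite sub0r normrN ger0_norm; last exact: v_ge0.
  apply: le_lt_trans vm; apply: v_ni; near: n; exact: nbhs_infty_ge.
apply: contrapT => /forallNP ev.
have [M] := harmonic_sum_unbounded (w 1 / theta / e + 1).
apply/negP; rewrite -ltNge (@le_lt_trans _ _ (w 1 / theta / e)) ?ltrDl//.
rewrite ler_pdivlMr// mulr_suml ler_pdivlMr// mulrC.
apply: (@le_trans _ _ (theta * \sum_(1 <= j < M.+1) w j)); last first.
  by rewrite part_weight_sumE gerBl v_ge0.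
rewrite ler_pM2l//; apply: ler_sum_nat => -[//|j] _.
rewrite mulrC ler_pdivrMr ?ltr0n// mulrC leNgt; exact/negP/ev.
Unshelve. all: by end_near. Qed.

Lemma part_weight_sum_cvg : \sum_(1 <= j < M.+1) w j @[M --> \oo] --> w 1 / theta.
Proof.
have -> : (fun M => \sum_(1 <= j < M.+1) w j) =
    (fun M => (w 1 - M.+1%:R * w M.+1) / theta).
  by apply/funext => M; rewrite -part_weight_sumE mulrC mulKf// lt0r_neq0.
apply: cvgMl; rewrite -[X in _ --> X]subr0.
by apply: cvgB part_weight_tail_cvg0; exact: cvg_cst.
Qed.

(** m (m - 1) w m is nondecreasing because beta >= -2, so halving the argument
    costs at most a constant factor. *)
Lemma part_weight_half n k : (2 <= k)%N -> (k.*2 <= n)%N -> w (n - k) <= 6 * w n.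
Proof.
move=> k2 kn; pose u m := m%:R * (m%:R - 1) * w m.
have u_nd i m : (1 <= m)%N -> u m <= u (i + m)%N.
  move=> m1; elim: i => // i IH; rewrite (le_trans IH)// /u addSn.
  have im1 : (1 <= i + m)%N by rewrite (leq_trans m1) ?leq_addl.
  set p := (i + m)%N in im1 *.
  have -> : p.+1%:R * (p.+1%:R - 1) * w p.+1 = p%:R * (p%:R + 1 + beta) * w p.
    by rewrite natr1 -[RHS]mulrA -part_weightS// -natr1; ring.
  rewrite ler_wpM2r ?(ltW (part_weight_gt0 _ _))// ler_wpM2l//.
  by move: beta_gtN2; lra.
have u_le : u (n - k)%N <= u n by rewrite -{2}(subnKC (_ : k <= n)%N)// ?u_nd//; lia.
have wm0 : 0 < w (n - k) by apply: part_weight_gt0 => //; lia.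
have m2 : 2 <= (n - k)%:R :> R by rewrite ler_nat; lia.
have nm : n%:R <= 2 * (n - k)%:R :> R by rewrite -natrM ler_nat; lia.
have n0 : 2 <= n%:R :> R by rewrite ler_nat; lia.
have wn0 : 0 < w n by apply: part_weight_gt0 => //; lia.
move: u_le wm0 m2 nm n0 wn0; rewrite /u.
set m : R := (n - k)%:R; set p : R := n%:R => u_le wm0 m2 nm n0 wn0.
have c0 : 0 < m * (m - 1) by nra.
rewrite -(ler_pM2l c0) (le_trans u_le)// [leRHS]mulrA ler_wpM2r ?(ltW wn0)//.
have h1 : 0 <= (2 * m - p) * (p + 2 * m - 1) by rewrite mulr_ge0//; lra.
have h2 : 0 <= m * (m - 2) by rewrite mulr_ge0//; lra.
by move: h1 h2; lra.
Qed.

(** Parts of size more than M carry a share of the total weight which is small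
    with M, uniformly in n. *)
Lemma beta_tail_bound M n : (1 <= M)%N -> (M.*2 < n)%N ->
  0 <= \sum_(M.+1 <= j < n./2.+1) beta_weight beta n j <=
    12 * w n * (M.+1%:R * w M.+1 / theta).
Proof.
move=> M1 Mn; apply/andP; split.
  rewrite big_nat sumr_ge0// => j /andP[Mj jn].
  by rewrite ltW// beta_weight_gt0//; lia.
have wn : 0 < w n by apply: part_weight_gt0 => //; lia.
apply: (@le_trans _ _ (\sum_(M.+1 <= j < n./2.+1) 12 * w n * w j)).
  apply: ler_sum_nat => j /andP[Mj jn]; rewrite beta_weightE.
  have wj : 0 < w j by apply: part_weight_gt0 => //; lia.
  rewrite ler_wpM2r ?(ltW wj)// (_ : 12 = 2 * 6); last by ring.
  rewrite -[leRHS]mulrA ler_pM//.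
  - by rewrite subr_ge0 ler_nat; case: (_ == _).
  - by rewrite ltW// part_weight_gt0//; lia.
  - by rewrite gerBl.
  - by apply: part_weight_half; lia.
have wn12 : 0 <= 12 * w n by rewrite mulr_ge0// ltW.
rewrite -mulr_sumr ler_wpM2l// ler_pdivlMr// mulrC.
have := part_weight_sumE n./2.
rewrite (@big_cat_nat _ _ _ M.+1)//=; last by lia.
rewrite mulrDr part_weight_sumE => h.
have : 0 <= n./2.+1%:R * w n./2.+1 by rewrite mulr_ge0// ltW// part_weight_gt0.
by move: h; lra.
Qed.

Lemma beta_normalisation_ratio_cvg :
  beta_normalisation beta n / w n @[n --> \oo] --> 2 * (w 1 / theta).
Proof.
apply/cvgrPdist_le => e e0.
near \oo => M.
pose d := M.+1%:R * w M.+1 / theta.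
have d0 : 0 <= d.
  apply: divr_ge0 (ltW theta_gt0); rewrite mulr_ge0// ltW//.
  exact: part_weight_gt0.
have M1 : (1 <= M)%N by near: M; exact: nbhs_infty_ge.
(* The tail of the series and that of the finite sum cost 2 d and 12 d. *)
have de : d <= e / 28.
  rewrite ler_pdivrMr//; near: M.
  have e1 : 0 < e / 28 * theta by rewrite mulr_gt0// divr_gt0.
  have /cvgrPdist_le/(_ _ e1) := part_weight_tail_cvg0.
  apply: filterS => m; rewrite sub0r normrN; apply: le_trans; exact: ler_norm.
have SE : w 1 / theta = \sum_(1 <= j < M.+1) w j + d.
  apply: (mulfI (lt0r_neq0 theta_gt0)); rewrite mulrDr part_weight_sumE /d.
  by rewrite ![theta * _]mulrC !divfK ?lt0r_neq0// subrK.
near=> n.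
have Mn : (M.*2 < n)%N by near: n; exact: nbhs_infty_gt.
have wn : 0 < w n by apply: part_weight_gt0 => //; lia.
have : `|\sum_(1 <= j < M.+1) w j
    - \sum_(1 <= j < M.+1) w j * (w (n - j) / w n)| <= e / 8.
  near: n; have e1 : 0 < e / 8 by rewrite divr_gt0.
  by have /cvgrPdist_le/(_ _ e1) := @head_sum_cvg _ _ beta_gtN2 M.
set H := (X in `|_ - X| <= _) => He.
have /andP[T0] := beta_tail_bound M1 Mn.
rewrite (beta_normalisation_split _ Mn) -/d [X in _ - X]mulrDl.
have -> : 2 * (\sum_(1 <= j < M.+1) w j * w (n - j)) / w n = 2 * H.
  by rewrite -mulrA mulr_suml; congr (_ * _); apply: eq_bigr => j _; rewrite mulrA.
move: T0; set T := \sum_(M.+1 <= j < _) _ => T0 T1.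
have T0' : 0 <= T / w n by rewrite divr_ge0// ltW.
have T1' : T / w n <= 12 * d by rewrite ler_pdivrMr// mulrAC.
rewrite SE; move: He; rewrite !ler_norml => /andP[H0 H1].
by apply/andP; split; lra.
Unshelve. all: by end_near. Qed.

Lemma beta_mass_cvg k : (1 <= k)%N ->
  beta_mass beta n [:: (n - k)%N; k] @[n --> \oo] --> w k * theta / w 1.
Proof.
move=> k1.
have w1 : w 1 != 0 by rewrite lt0r_neq0// part_weight_gt0.
have t0 : theta != 0 by rewrite lt0r_neq0.
have : 2 * w k * (w (n - k) / w n) * (beta_normalisation beta n / w n)^-1 @[n --> \oo]
    --> (2 * w k * 1 * (2 * (w 1 / theta))^-1 : R).
  apply: cvgM; first by apply: cvgMr; exact: part_weight_ratio_cvg.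
  apply: cvgV beta_normalisation_ratio_cvg.
  by rewrite mulf_neq0 ?pnatr_eq0// mulf_neq0// invr_eq0.
rewrite (_ : 2 * w k * 1 * _ = w k * theta / w 1); last by field; rewrite t0 w1.
apply: cvg_trans; apply: near_eq_cvg; near=> n.
rewrite beta_massE//; near: n; exact: nbhs_infty_gt.
Unshelve. all: by end_near. Qed.

Lemma beta_infinite_massE k :
  beta_infinite_mass beta (infinite_pair k) = w k.+1 * theta / w 1.
Proof.
rewrite /beta_infinite_mass /partition_length /infinite_multiplicity /=.
rewrite /beta_geometric -/theta /part_weight.
have -> : k%:R + 1 - theta = k.+1%:R + 1 + beta by rewrite /theta -natr1; ring.
have -> : 1 - theta = 1%:R + 1 + beta by rewrite /theta; ring.
have G1 : Gamma (1%:R + 1 + beta) != 0.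
  by rewrite lt0r_neq0// Gamma_beta_gt0.
have f1 : k.+1`!%:R != 0 :> R by rewrite pnatr_eq0 -lt0n fact_gt0.
have -> : (1%N)`! = 1%N by [].
by field; rewrite f1 G1.
Qed.

Lemma beta_infinite_mass_sum :
  \sum_(0 <= k < M) beta_infinite_mass beta (infinite_pair k) @[M --> \oo] --> (1 : R).
Proof.
have w1 : w 1 != 0 by rewrite lt0r_neq0// part_weight_gt0.
have t0 : theta != 0 by rewrite lt0r_neq0.
have : (\sum_(1 <= j < M.+1) w j) * (theta / w 1) @[M --> \oo]
    --> w 1 / theta * (theta / w 1).
  by apply: cvgMl; exact: part_weight_sum_cvg.
rewrite (_ : w 1 / theta * _ = 1); last by field; rewrite w1 t0.
apply: cvg_trans; apply: near_eq_cvg; apply: nearW => M.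
rewrite mulr_suml big_add1/=; apply: eq_bigr => k _.
by rewrite beta_infinite_massE mulrA.
Qed.

End convergent_case.

(** * Trees seen up to a given radius *)

Lemma ltree_iso_words (t s : ltree) : val t = val s -> ltree_iso t s.
Proof.
by move=> ts; exists id; split => //; rewrite ts; split => // u su; exists u.
Qed.

Lemma truncation0 (t : tree) : truncation 0 t = leaf.
Proof.
apply/pi_ltreeP/ltree_iso_words/seteqP; have [r0 _ _] := ltreeP (repr t).
split=> [u [_]|_ ->]; first by rewrite leqn0 => /eqP/size0nil.
by split.
Qed.

Lemma truncation_truncation m n (t : tree) : (m <= n)%N ->
  truncation m (truncation n t) = truncation m t.
Proof.
move=> mn; rewrite {2}/truncation truncation_pi.
apply/pi_ltreeP/ltree_iso_words/seteqP; split=> [u [[tu _] um]|u [tu um]] //.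
by split=> //; split=> //; exact: leq_trans mn.
Qed.

Lemma truncation_join k (t s : tree) :
  truncation k.+1 (join t s) = join (truncation k t) (truncation k s).
Proof.
rewrite {1}/join truncation_pi join_pi.
apply/pi_ltreeP/ltree_iso_words/seteqP.
by split=> [[|[|[|i]] u]//= []|[|[|[|i]] u]//= []].
Qed.

Lemma spine_treeE (tau : nat -> tree) :
  spine_tree tau = join (spine_tree (tau \o S)) (tau 0%N).
Proof.
rewrite -[tau 0%N in RHS]reprK join_pi; apply/pi_ltreeP/ltree_iso_words.
exact: spine_words_rec.
Qed.

Lemma complete_binary_treeE :
  complete_binary_tree = join complete_binary_tree complete_binary_tree.
Proof.
rewrite join_pi; apply/pi_ltreeP/ltree_iso_words/seteqP.
by split=> [[|[|[|i]] u]//|[|[|[|i]] u]//].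
Qed.

Section determined.
Context {T : Type}.

Definition determined (k : nat) (g : tree -> T) : Prop :=
  forall t s, truncation k t = truncation k s -> g t = g s.

Lemma determined0 (g : tree -> T) t : determined 0 g -> g t = g leaf.
Proof. by apply; rewrite !truncation0. Qed.

Lemma determined_joinl k (g : tree -> T) s :
  determined k.+1 g -> determined k (fun t => g (join t s)).
Proof. by move=> gk t t' tt'; apply: gk; rewrite !truncation_join tt'. Qed.

End determined.

(** Finite branching makes every truncation a finite tree, and a finite tree is
    coded by a list of words. *)
Lemma truncations_enumerable k :
  exists e : nat -> tree, forall t, exists n, truncation k t = e n.
Proof.
have fin_words (t : ltree) m : finite_set [set u | val t u /\ (size u <= m)%N].
  have [_ tp tf] := ltreeP t; elim: m => [|m IH].
    apply: (@sub_finite_set _ _ [set [::]]) => // u [_].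
    by rewrite leqn0 => /eqP/size0nil.
  apply: (@sub_finite_set _ _ ([set u | val t u /\ (size u <= m)%N] `|`
      \bigcup_(u in [set u | val t u /\ (size u <= m)%N])
        (rcons u @` [set i | val t (rcons u i)]))).
    case/lastP => [|u i] [tu um]; first by left.
    right; exists u => //=; last by exists i.
    by rewrite size_rcons in um; have := tp _ tu; rewrite parent_rcons.
  rewrite finite_setU; split=> //; apply: bigcup_finite => // u _.
  exact: finite_image.
pose decode (s : seq (seq nat)) : tree :=
  if pselect (is_labelled_tree [set` s]) is left h then \pi_tree%qT (ltree_of h)
  else leaf.
exists (decode \o odflt [::] \o unpickle) => t.
have /finite_seqP[s sE] := fin_words (repr t) k; exists (pickle s).
rewrite /comp pickleK /= /decode; case: pselect => [h|]; last first.
  by rewrite -sE; have := truncation_is_labelled_tree k (repr t).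
exact/pi_ltreeP/ltree_iso_words.
Qed.

Section local_topology_truncation.
Context {R : realType}.

Lemma dloc_lt_truncation k t s :
  (dloc t s : R) < expR (- k%:R) -> truncation k t = truncation k s.
Proof.
rewrite -lte_fin dlocE; apply: contraPP => tsk; apply/negP; rewrite -leNgt.
rewrite -[(expR _)%:E]/(expeR (- k%:R%:E)) lee_expeR leeN2.
by apply: ereal_inf_lbound; exists k.
Qed.

Lemma truncation_dloc_le k t s :
  truncation k t = truncation k s -> (dloc t s : R) <= expR (- k%:R).
Proof.
move=> tsk; rewrite -lee_fin dlocE -[(expR _)%:E]/(expeR (- k%:R%:E)).
rewrite lee_expeR leeN2; apply: le_ereal_inf_tmp => _ [m /= tsm <-].
rewrite lee_fin ler_nat leqNgt; apply/negP => mk; apply: tsm.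
by rewrite -(truncation_truncation t (ltnW mk)) tsk truncation_truncation// ltnW.
Qed.

Lemma open_determined k (A : set (loctree R)) : determined k A -> open A.
Proof.
move=> Ak; rewrite openE => t At; apply/nbhs_ballP.
exists (expR (- k%:R)) => /=; first exact: expR_gt0.
by move=> s /dloc_lt_truncation /Ak <-.
Qed.

Lemma measurable_determined k (A : set (loctree R)) :
  determined k A -> measurable A.
Proof. by move=> /open_determined Ao; exact: sub_sigma_algebra. Qed.

Lemma nbhs_truncation (t : loctree R) (U : set (loctree R)) : nbhs t U ->
  exists k, forall s, truncation k t = truncation k s -> U s.
Proof.
move=> /nbhs_ballP[e /= e0 eU].
have [k ke] : exists k : nat, expR (- k%:R) < e.
  exists (Num.truncn (- ln e)).+1.
  by rewrite -[ltRHS]lnK ?posrE// ltr_expR ltrNl truncnS_gt.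
by exists k => s /truncation_dloc_le tsk; apply: eU; exact: le_lt_trans ke.
Qed.

Lemma measurable_fun_determined k (g : loctree R -> R) :
  determined k g -> measurable_fun setT g.
Proof.
move=> gk _ B _; rewrite setTI; apply: (@measurable_determined k).
by move=> t s /gk; rewrite /preimage/= => ->.
Qed.

End local_topology_truncation.

(** * Weak convergence for the local topology *)

Section expectation.
Context {R : realType}.
Variable q : split_law R.

Definition expectation (n : nat) (g : tree -> R) : R :=
  \sum_(x <- outcomes q n) x.1 * g x.2.

Lemma expectation_cst n c : expectation n (fun=> c) = c.
Proof. by rewrite /expectation -mulr_suml outcomes_sum mul1r. Qed.

Lemma le_expectation n g h : (forall t, g t <= h t) -> expectation n g <= expectation n h.
Proof.
move=> gh; rewrite /expectation big_seq [leRHS]big_seq; apply: ler_sum => x xn.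
by rewrite ler_wpM2l// (outcomes_ge0 xn).
Qed.

Lemma expectation_ge0 n g : (forall t, 0 <= g t) -> 0 <= expectation n g.
Proof. by move=> g0; rewrite -[leLHS](expectation_cst n); exact: le_expectation. Qed.

Lemma expectationZ n c g : expectation n (fun t => c * g t) = c * expectation n g.
Proof. by rewrite /expectation mulr_sumr; apply: eq_bigr => x _; rewrite mulrCA. Qed.

Lemma eq_expectation n g h : g =1 h -> expectation n g = expectation n h.
Proof. by move=> gh; apply: eq_bigr => x _; rewrite gh. Qed.

Lemma expectation_rec n g : (2 <= n)%N ->
  expectation n g = \sum_(1 <= k < n./2.+1) q n [:: (n - k)%N; k] *
    expectation k (fun s => expectation (n - k) (fun t => g (join t s))).
Proof.
move=> n2; rewrite /expectation outcomesE// big_flatten big_map.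
apply: eq_bigr => k _; rewrite big_allpairs_dep/= exchange_big/= mulr_sumr.
apply: eq_bigr => y _; rewrite mulr_sumr mulr_sumr; apply: eq_bigr => x _.
by rewrite -!mulrA; congr (_ * _); rewrite mulrCA.
Qed.

Lemma integral_MB n (g : loctree R -> R) :
  measurable_fun setT g -> (forall t, 0 <= g t) ->
  (\int[MB q n]_t (g t)%:E)%E = (expectation n g)%:E.
Proof.
move=> mg g0.
pose x0 : R * loctree R := (0, leaf).
pose w i : {nonneg R} := NngNum (normr_ge0 (nth x0 (outcomes q n) i).1).
pose m i := mscale (w i) (\d_(nth x0 (outcomes q n) i).2).
have w_ge0 i : (i < size (outcomes q n))%N ->
    (w i)%:num = (nth x0 (outcomes q n) i).1.
  by move=> /mem_nth-/(_ x0) /outcomes_ge0 /ger0_norm.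
rewrite (@eq_measure_integral _ _ _ _ (msum m (size (outcomes q n)))); last first.
  move=> A _ _; rewrite /= /MB /msum/= (big_nth x0) big_mkord.
  by apply: eq_bigr => i _; rewrite /m /mscale/= w_ge0.
have mEg : measurable_fun setT (EFin \o g) by exact/measurable_EFinP.
rewrite ge0_integral_measure_sum//; last by move=> t _; rewrite lee_fin.
rewrite /expectation (big_nth x0) big_mkord -sumEFin; apply: eq_bigr => i _.
rewrite /m ge0_integral_mscale//; last by move=> t _; rewrite lee_fin.
by rewrite integral_dirac// diracT mul1e /= -EFinM w_ge0.
Qed.

End expectation.

Section bounded_integral.
Context {R : realType} (d : measure_display) (T : measurableType d).
Variables (P : probability T R) (f : T -> R) (C : R).
Hypotheses (mf : measurable_fun setT f) (fC : forall t, `|f t| <= C).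

Lemma integrable_bounded : P.-integrable setT (EFin \o f).
Proof.
apply: measurable_bounded_integrable => //; first exact: fin_num_fun_lty.
exists C; split; first exact: num_real.
by move=> x Cx t _; rewrite /= (le_trans (fC t))// ltW.
Qed.

Lemma EFin_Rintegral : (\int[P]_t (f t)%:E)%E = (\int[P]_t f t)%:E.
Proof.
rewrite /Rintegral fineK//.
by apply: integrable_fin_num; [exact: measurableT|exact: integrable_bounded].
Qed.

Let integral_cst1 c : \int[P]_t c = c.
Proof.
rewrite Rintegral_cst; last exact: measurableT.
by rewrite [X in c * fine X](probability_setT P) mulr1.
Qed.

Let integrable_cst1 c : P.-integrable setT (EFin \o cst c).
Proof. exact: finite_measure_integrable_cst. Qed.

Lemma RintegralDcst c : \int[P]_t (f t + c) = \int[P]_t f t + c.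
Proof.
transitivity (\int[P]_t f t + \int[P]_t c); last by congr (_ + _); exact: integral_cst1.
by apply: RintegralD; [exact: measurableT|exact: integrable_bounded|exact: integrable_cst1].
Qed.

Lemma RintegralBcst c : \int[P]_t (c - f t) = c - \int[P]_t f t.
Proof.
transitivity (\int[P]_t c - \int[P]_t f t); last by congr (_ - _); exact: integral_cst1.
by apply: RintegralB; [exact: measurableT|exact: integrable_cst1|exact: integrable_bounded].
Qed.

End bounded_integral.

Section portmanteau.
Context {R : realType}.

(** The best lower approximation of h which only sees the ball of radius k. *)
Definition lower_envelope (h : loctree R -> R) (k : nat) (t : loctree R) : R :=
  inf [set h s | s in [set s : loctree R | truncation k s = truncation k t]].

Section lower_envelope.
Variables (h : loctree R -> R) (B : R).
Hypothesis h0 : forall t, 0 <= h t.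

Let has_inf_class k t :
  has_inf [set h s | s in [set s : loctree R | truncation k s = truncation k t]].
Proof. by split; [exists (h t), t|exists 0 => _ [s _ <-]]. Qed.

Lemma lower_envelope_determined k : determined k (lower_envelope h k).
Proof. by move=> t s ts; rewrite /lower_envelope ts. Qed.

Lemma lower_envelope_le k t : lower_envelope h k t <= h t.
Proof. by apply: ge_inf; [have [] := has_inf_class k t|exists t]. Qed.

Lemma lower_envelope_ge k t c :
  (forall s, truncation k s = truncation k t -> c <= h s) ->
  c <= lower_envelope h k t.
Proof.
move=> ch; apply: lb_le_inf; first by have [] := has_inf_class k t.
by move=> _ [s /= ts <-]; exact: ch.
Qed.

Lemma lower_envelope_ge0 k t : 0 <= lower_envelope h k t.
Proof. by apply: lower_envelope_ge => s _. Qed.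

Lemma lower_envelope_nondecreasing t :
  nondecreasing_seq ((lower_envelope h)^~ t).
Proof.
apply/nondecreasing_seqP => k; apply: lower_envelope_ge => s st.
apply: (le_trans _ (lower_envelope_le k s)); rewrite le_eqVlt; apply/orP; left.
apply/eqP/lower_envelope_determined.
by rewrite -(truncation_truncation t (leqnSn k)) -st truncation_truncation.
Qed.

Lemma lower_envelope_cvg t : {for t, continuous h} ->
  lower_envelope h k t @[k --> \oo] --> h t.
Proof.
move=> /cvgrPdist_le hc; apply/cvgrPdist_le => e e0.
have [k hk] := nbhs_truncation (hc e e0).
near=> n; rewrite ger0_norm ?subr_ge0 ?lower_envelope_le// lerBlDl -lerBlDr.
apply: lower_envelope_ge => s st; rewrite lerBlDl -lerBlDr (le_trans (ler_norm _))//.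
have kn : (k <= n)%N by near: n; exact: nbhs_infty_ge.
by apply: hk; rewrite -(truncation_truncation t kn) -st truncation_truncation.
Unshelve. all: by end_near. Qed.

End lower_envelope.

Lemma measurable_continuous (h : loctree R -> R) :
  continuous h -> (forall t, 0 <= h t) -> measurable_fun setT h.
Proof.
move=> hc h0; apply: (@measurable_fun_cvg _ _ _ _ (lower_envelope h)).
  move=> k; apply: (@measurable_fun_determined _ k).
  exact: lower_envelope_determined.
by move=> t _; exact: (lower_envelope_cvg h0 (hc t)).
Qed.

(** Weak convergence may be tested, as lower bounds only, on functions of a
    bounded neighbourhood of the root: a continuous function is the increasing
    limit of its lower envelopes, and upper bounds follow by changing f to -f. *)
Lemma weak_cvg_determined (mu : nat -> probability (loctree R) R)
    (nu : probability (loctree R) R) :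
  (forall k (g : loctree R -> R) B, determined k g ->
    (forall t, 0 <= g t <= B) -> forall e, 0 < e ->
    \forall n \near \oo, \int[nu]_t g t - e <= \int[mu n]_t g t) ->
  weak_cvg mu nu.
Proof.
move=> lower.
have lower_continuous (h : loctree R -> R) B : continuous h ->
    (forall t, 0 <= h t <= B) -> forall e, 0 < e ->
    \forall n \near \oo, \int[nu]_t h t - e <= \int[mu n]_t h t.
  move=> hc hB e e0.
  have h0 t : 0 <= h t by have /andP[] := hB t.
  have mh := measurable_continuous hc h0.
  have lB k t : 0 <= lower_envelope h k t <= B.
    rewrite lower_envelope_ge0//= (le_trans (lower_envelope_le _ _ _))//.
    by have /andP[] := hB t.
  have hle t : `|h t| <= B by have /andP[? ?] := hB t; rewrite ger0_norm.
  have lle k t : `|lower_envelope h k t| <= B.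
    by have /andP[? ?] := lB k t; rewrite ger0_norm.
  have ml k : measurable_fun setT (lower_envelope h k).
    apply: (@measurable_fun_determined _ k); exact: lower_envelope_determined.
  have cvg_int : \int[nu]_t lower_envelope h k t @[k --> \oo] --> \int[nu]_t h t.
    apply: fine_cvg; rewrite fineK; last first.
      by apply: integrable_fin_num; [exact: measurableT|exact: integrable_bounded mh hle].
    have -> : (\int[nu]_t (h t)%:E =
        \int[nu]_t limn (fun k => (lower_envelope h k t)%:E))%E.
      apply: eq_integral => t _; apply/esym/cvg_lim => //.
      by apply: cvg_EFin; [exact: nearW|exact: (lower_envelope_cvg h0 (hc t))].
    apply: cvg_monotone_convergence => //.
    - by move=> k; exact/measurable_EFinP.
    - by move=> k t _; rewrite lee_fin lower_envelope_ge0.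
    - by move=> t _ m k mk; rewrite lee_fin; exact: lower_envelope_nondecreasing.
  have e2 : 0 < e / 2 by rewrite divr_gt0.
  have [k ke] : exists k, \int[nu]_t h t - e / 2 <= \int[nu]_t lower_envelope h k t.
    have /cvgrPdist_le/(_ _ e2)[k _ /(_ k (leqnn k))] := cvg_int.
    by move=> /(le_trans (ler_norm _)) ?; exists k; rewrite lerBlDl -lerBlDr.
  have := lower k _ B (@lower_envelope_determined h k) (lB k) _ e2.
  apply: filterS => n le_n.
  apply: (@le_trans _ _ (\int[mu n]_t lower_envelope h k t)); last first.
    apply: le_Rintegral => //.
    - exact: integrable_bounded (ml k) (lle k).
    - exact: integrable_bounded mh hle.
    - by move=> t _; exact: lower_envelope_le.
  by move: ke le_n; lra.
move=> f fc [M [Mr fM]].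
have [C fC] : exists C, forall t, `|f t| <= C.
  exists (`|M| + 1) => t; apply: fM => //.
  by rewrite (le_lt_trans (ler_norm M))// ltrDl.
have bounds t : 0 <= f t + C <= 2 * C /\ 0 <= C - f t <= 2 * C.
  by have := fC t; rewrite ler_norml => /andP[? ?]; split; apply/andP; split; lra.
have cadd : continuous (fun t : loctree R => f t + C).
  by move=> t; exact: cvgD (fc t) (cvg_cst _).
have csub : continuous (fun t : loctree R => C - f t).
  by move=> t; exact: cvgB (cvg_cst _) (fc t).
have mf : measurable_fun setT f.
  have -> : f = (fun t => (f t + C) - C) by apply/funext => t; rewrite addrK.
  apply: measurable_funB => //; apply: measurable_continuous cadd _.
  by move=> t; have [/andP[]] := bounds t.
rewrite (EFin_Rintegral nu mf fC) (_ : (fun n => _) = EFin \o (fun n => \int[mu n]_t f t)); last first.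
  by apply/funext => n /=; rewrite (EFin_Rintegral (mu n) mf fC).
apply: cvg_EFin; first exact: nearW.
apply/cvgrPdist_le => e e0.
have lo := lower_continuous _ _ cadd (fun t => (bounds t).1) e e0.
have hi := lower_continuous _ _ csub (fun t => (bounds t).2) e e0.
near=> n.
have lo_n : \int[nu]_t (f t + C) - e <= \int[mu n]_t (f t + C) by near: n.
have hi_n : \int[nu]_t (C - f t) - e <= \int[mu n]_t (C - f t) by near: n.
rewrite !(RintegralDcst _ mf fC) in lo_n; rewrite !(RintegralBcst _ mf fC) in hi_n.
by rewrite /= ler_norml; apply/andP; split; move: lo_n hi_n; lra.
Unshelve. all: by end_near. Qed.

End portmanteau.

(** * Convergence to the complete binary tree *)

Section binary_limit.
Context {R : realType}.
Variable q : split_law R.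

Let binary_ball (k : nat) (t : tree) : R :=
  (truncation k t == truncation k complete_binary_tree)%:R.

Let binary_ball_join k t s :
  binary_ball k t * binary_ball k s <= binary_ball k.+1 (join t s).
Proof.
rewrite /binary_ball [in leRHS]complete_binary_treeE !truncation_join.
case: (truncation k t =P _) => [->|_]; last by rewrite mul0r.
by case: (truncation k s =P _) => [->|_]; rewrite ?eqxx /= ?mulr0 ?mulr1 ?ler0n.
Qed.

Hypothesis split_cvg0 : forall k, (1 <= k)%N ->
  q n [:: (n - k)%N; k] @[n --> \oo] --> (0 : R).

(** Both subtrees of the root are large with high probability, so that the
    induction hypothesis applies to both. *)
Let binary_ball_cvg1 k e : 0 < e ->
  \forall n \near \oo, 1 - e <= expectation q n (binary_ball k).
Proof.
have ball_ge0 m t : 0 <= binary_ball m t by rewrite /binary_ball ler0n.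
elim: k e => [|k IH] e e0.
  apply: nearW => n; rewrite -[leRHS](_ : 1 = _) ?gerBl ?ltW//.
  rewrite -[LHS](expectation_cst q n); apply: eq_expectation => t.
  by rewrite /binary_ball !truncation0 eqxx.
(* One factor 1 - d is lost to the small splits and one to each subtree. *)
have [d [d0 d3 d1]] : exists d, [/\ 0 < d, 3 * d <= e & d <= 1 / 3].
  exists (Num.min e 1 / 3); split.
  - by rewrite divr_gt0// lt_min e0 ltr01.
  - by rewrite mulrC divfK// ge_min lexx.
  - by rewrite ler_pM2r// ge_min lexx orbT.
have [N _ hN] := IH _ d0.
near=> n.
have nN : (N.+1.*2 < n)%N by near: n; exact: nbhs_infty_gt.
have small : \sum_(1 <= j < N.+1) q n [:: (n - j)%N; j] <= d.
  near: n.
  have sum0 : \sum_(1 <= j < N.+1) q n [:: (n - j)%N; j] @[n --> \oo] --> (0 : R).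
    rewrite -[X in _ --> X](_ : \sum_(1 <= j < N.+1) 0 = _); last by rewrite big1.
    rewrite !big_nat; under eq_fun do rewrite big_nat.
    apply: cvg_big => [|j /andP[j1 _]]; first exact: add_continuous.
    exact: split_cvg0.
  have /cvgrPdist_le/(_ _ d0) := sum0.
  by apply: filterS => m; rewrite sub0r normrN; apply: le_trans; exact: ler_norm.
have n2 : (2 <= n)%N by lia.
have total := split_mass_sum q n2.
rewrite (@big_cat_nat _ _ _ N.+1) in total; [|by []|by lia].
rewrite expectation_rec//.
rewrite (@big_cat_nat _ _ _ N.+1)//=; last by lia.
apply: (@le_trans _ _ (\sum_(N.+1 <= j < n./2.+1) q n [:: (n - j)%N; j] * (1 - d) ^+ 2)).
  rewrite -mulr_suml; move: total; set A := (X in _ + X = 1) => total.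
  have A1 : 1 - d <= A by lra.
  apply: (@le_trans _ _ ((1 - d) * (1 - d) ^+ 2)).
    by nra.
  by rewrite ler_wpM2r// sqr_ge0.
rewrite -[leLHS]add0r lerD//.
  rewrite big_nat sumr_ge0// => j _; rewrite mulr_ge0 ?split_mass_ge0//.
  by do 2![apply: expectation_ge0 => ?].
apply: ler_sum_nat => j /andP[Nj jn]; rewrite ler_wpM2l ?split_mass_ge0//.
apply: (@le_trans _ _ (expectation q (n - j) (binary_ball k) * expectation q j (binary_ball k))).
  have d1' : 0 <= 1 - d by lra.
  by rewrite expr2 ler_pM// hN//=; lia.
rewrite -expectationZ; apply: le_expectation => s.
rewrite mulrC -expectationZ; apply: le_expectation => t.
by rewrite mulrC; exact: binary_ball_join.
Unshelve. all: by end_near. Qed.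

Lemma binary_tree_limit :
  weak_cvg (fun n => MB q n) \d_(complete_binary_tree : loctree R).
Proof.
apply: weak_cvg_determined => k g B gk gB e e0.
have g0 t : 0 <= g t by have /andP[] := gB t.
have mg := measurable_fun_determined gk.
set c := complete_binary_tree : loctree R.
have B0 : 0 <= B by have /andP[] := gB c; exact: le_trans.
have d0 : 0 < e / (B + 1) by rewrite divr_gt0// ltr_wpDl.
have := binary_ball_cvg1 k d0; apply: filterS => n.
have -> : \int[\d_c]_t g t = g c.
  by rewrite /Rintegral integral_dirac ?diracT ?mul1e//; exact/measurable_EFinP.
have -> : \int[MB q n]_t g t = expectation q n g by rewrite /Rintegral integral_MB.
move=> ball_n; apply: (@le_trans _ _ (g c * expectation q n (binary_ball k))).
  apply: (@le_trans _ _ (g c * (1 - e / (B + 1)))); last by rewrite ler_wpM2l.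
  rewrite mulrBr mulr1 lerD2l lerN2 mulrCA ler_piMr ?(ltW e0)//.
  rewrite ler_pdivrMr ?ltr_wpDl// mul1r ler_wpDr//.
  by have /andP[] := gB c.
rewrite -expectationZ; apply: le_expectation => t; rewrite /binary_ball.
by case: eqP => [/gk ->|_]; rewrite ?mulr1// mulr0.
Qed.

End binary_limit.

(** * Convergence to the tree with an infinite spine *)

Section spine_functional.
Context {R : realType}.
Variables (q : split_law R) (qoo : infinite_partition -> R).

(** The expectation of g over the first r vertices of the spine, restricted to
    the event that the finite parts there are at most M. *)
Fixpoint spine_functional (M r : nat) (g : tree -> R) : R :=
  match r with
  | 0%N => g leaf
  | r'.+1 => \sum_(0 <= k < M) qoo (infinite_pair k) *
      expectation q k.+1 (fun s => spine_functional M r' (fun t => g (join t s)))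
  end.

Lemma spine_functionalB M r f g :
  spine_functional M r (fun t => f t - g t) =
  spine_functional M r f - spine_functional M r g.
Proof.
elim: r f g => //= r IH f g; rewrite -sumrB; apply: eq_bigr => k _.
rewrite -mulrBr; congr (_ * _); rewrite /expectation -sumrB.
by apply: eq_bigr => x _; rewrite IH mulrBr.
Qed.

Lemma spine_functional_cst M r c :
  spine_functional M r (fun=> c) = c * (\sum_(0 <= k < M) qoo (infinite_pair k)) ^+ r.
Proof.
elim: r => [|r IH]/=; first by rewrite mulr1.
under eq_bigr do rewrite IH expectation_cst.
by rewrite -mulr_suml exprS mulrCA.
Qed.

Lemma spine_functional_ge0 M r g :
  (forall k, 0 <= qoo (infinite_pair k)) -> (forall t, 0 <= g t) ->
  0 <= spine_functional M r g.
Proof.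
move=> qoo0; elim: r g => //= r IH g g0; apply: sumr_ge0 => k _.
by rewrite mulr_ge0//; apply: expectation_ge0 => s; exact: IH.
Qed.

Hypothesis split_cvg : forall k,
  q n [:: (n - k.+1)%N; k.+1] @[n --> \oo] --> qoo (infinite_pair k).

(** Keeping only the splits whose smaller part is at most M turns the expectation
    into a sum of a fixed number of terms, each of which converges. *)
Lemma expectation_lower_bound M r g : determined r g -> (forall t, 0 <= g t) ->
  exists2 u : nat -> R, u n @[n --> \oo] --> spine_functional M r g &
    forall n, u n <= expectation q n g.
Proof.
elim: r g => [|r IH] g gr g0 /=.
  exists (fun=> g leaf) => [|n]; first exact: cvg_cst.
  rewrite (@eq_expectation _ q n g (fun=> g leaf)) ?expectation_cst// => t.
  exact: determined0.
have /choice[u uP] : forall s, exists u : nat -> R,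
    u n @[n --> \oo] --> spine_functional M r (fun t => g (join t s)) /\
    forall n, u n <= expectation q n (fun t => g (join t s)).
  move=> s; have [||u u1 u2] := IH (fun t => g (join t s)).
  - exact: determined_joinl.
  - by move=> t; exact: g0.
  - by exists u.
pose U n := \sum_(0 <= k < M) q n [:: (n - k.+1)%N; k.+1] *
  expectation q k.+1 (fun s => u s (n - k.+1)%N).
exists (fun n => if (M.*2.+1 < n)%N then U n else 0) => [|n].
  have : U n @[n --> \oo] --> spine_functional M r.+1 g.
    apply: cvg_big => [|k _]; first exact: add_continuous.
    apply: cvgM; first exact: split_cvg.
    apply: cvg_big => [|x _]; first exact: add_continuous.
    apply: cvgMr; have [+ _] := uP x.2.
    by apply: cvg_comp; exact: cvg_subnr.
  apply: cvg_trans; apply: near_eq_cvg; near=> n; rewrite ifT//.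
  by near: n; exact: nbhs_infty_gt.
case: ifPn => [Mn|_]; last exact: expectation_ge0.
rewrite expectation_rec; last by lia.
rewrite (@big_cat_nat _ _ _ M.+1)//=; last by lia.
rewrite -[leLHS]addr0 lerD//; last first.
  apply: sumr_ge0 => k _; rewrite mulr_ge0 ?split_mass_ge0//.
  by do 2![apply: expectation_ge0 => ?].
rewrite big_add1/=; apply: ler_sum => k _.
rewrite ler_wpM2l ?split_mass_ge0//; apply: le_expectation => s.
by have [_] := uP s; exact.
Unshelve. all: by end_near. Qed.

End spine_functional.

Section infinite_spine.
Context {R : realType}.
Variables (q : split_law R) (qoo : infinite_partition -> R).
Variables (d : measure_display) (Omega : measurableType d) (P : probability Omega R).
Variables (K : nat -> Omega -> nat) (tau : nat -> Omega -> loctree R).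
Hypothesis K_tau_measurable :
  forall n, measurable_fun setT (K n) /\ measurable_fun setT (tau n).
Hypothesis K_tau_independent : mutually_independent P (fun n w => (K n w, tau n w)).
Hypothesis K_law : forall n k, P (K n @^-1` [set k.+1]) = (qoo (infinite_pair k))%:E.
Hypothesis tau_law : forall n k (A : set (loctree R)), measurable A ->
  P (K n @^-1` [set k.+1] `&` tau n @^-1` A) =
  (P (K n @^-1` [set k.+1]) * MB q k.+1 A)%E.

Let X (n : nat) (w : Omega) : nat * loctree R := (K n w, tau n w).
Let spine (j : nat) (w : Omega) : loctree R := spine_tree (fun n => tau (j + n) w).

Let measurable_X n : measurable_fun setT (X n).
Proof. by have [? ?] := K_tau_measurable n; exact: measurable_fun_pair. Qed.

Let spineE j w : spine j w = join (spine j.+1 w) (tau j w).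
Proof.
rewrite /spine spine_treeE addn0; congr (join (spine_tree _) _).
by apply/funext => n /=; rewrite addnS.
Qed.

Let measurable_spine_determined k (A : set tree) j :
  determined k A -> measurable [set w | A (spine j w)].
Proof.
elim: k A j => [|k IH] A j Ak.
  have [Al|nAl] := pselect (A leaf).
    rewrite (_ : [set w | _] = setT)//; apply/seteqP; split=> // w _ /=.
    by rewrite (determined0 _ Ak).
  rewrite (_ : [set w | _] = set0)//; apply/seteqP; split=> // w /=.
  by rewrite (determined0 _ Ak).
have [e eP] := truncations_enumerable k.
rewrite (_ : [set w | _] = \bigcup_n ([set w | truncation k (tau j w) = e n] `&`
    [set w | A (join (spine j.+1 w) (e n))])); last first.
  have AE w : A (spine j w) = A (join (spine j.+1 w) (truncation k (tau j w))).
    by rewrite spineE; apply: Ak; rewrite !truncation_join truncation_truncation.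
  apply/seteqP; split=> [w /=|w [n _ /= [te]]]; rewrite AE; last by rewrite te.
  by have [n en] := eP (tau j w); rewrite en => Aw; exists n.
apply: bigcupT_measurable => n; apply: measurableI; last first.
  by apply: (IH (fun t => A (join t (e n)))); exact: determined_joinl.
have mtau := (K_tau_measurable j).2.
rewrite -[X in measurable X]setTI.
apply: (mtau measurableT [set t | truncation k t = e n]).
by apply: (@measurable_determined _ k) => t s /= ->.
Qed.

(** Only countably many balls of a given radius exist, hence sets determined by a
    ball have measurable preimages; an open set is a countable union of such sets. *)
Let measurable_spine j : measurable_fun setT (spine j).
Proof.
apply: (@measurability _ _ _ _ _ _ (@open (loctree R))) => //.
move=> _ [U Uo <-]; rewrite setTI.
pose B k : set tree := [set t | forall s, truncation k t = truncation k s -> U s].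
rewrite (_ : _ @^-1` U = \bigcup_k [set w | B k (spine j w)]); last first.
  apply/seteqP; split=> [w Uw|w [k _]]; last exact.
  by have [k kU] := nbhs_truncation (open_nbhs_nbhs (conj Uo Uw)); exists k.
apply: bigcupT_measurable => k; apply: (@measurable_spine_determined k).
by move=> t s ts; rewrite /B/= ts.
Qed.

(** Integrating over such events in the induction below plays the role of
    conditioning on the first j vertices of the spine. *)
Let past (C : nat -> set (nat * loctree R)) (j : nat) : set Omega :=
  \bigcap_(i < j) (X i @^-1` C i).

Let past_iota C j : past C j = \bigcap_(i in [set` iota 0 j]) (X i @^-1` C i).
Proof.
rewrite /past; congr bigcap; apply/seteqP.
by split=> i; rewrite /mkset mem_iota add0n.
Qed.

Let past0 C : past C 0 = setT.
Proof. by apply/seteqP; split=> // w _ i. Qed.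

Let pastS C j : past C j.+1 = past C j `&` X j @^-1` C j.
Proof.
apply/seteqP; split=> [w h|w [h hj] i].
  by split=> [i ij|]; apply: h => //=; exact: ltnW.
by rewrite /mkset ltnS leq_eqVlt => /predU1P[->//|]; exact: h.
Qed.

Let measurable_past C j : (forall i, measurable (C i)) -> measurable (past C j).
Proof.
move=> mC; elim: j => [|j IH]; first by rewrite past0.
rewrite pastS; apply: measurableI => //.
by rewrite -[X in measurable X]setTI; exact: measurable_X.
Qed.

Let prob_pastS C j : (forall i, measurable (C i)) ->
  (P (past C j.+1) = P (past C j) * P (X j @^-1` C j))%E.
Proof.
move=> mC; rewrite !past_iota (K_tau_independent (iota_uniq 0 j.+1) mC).
rewrite (K_tau_independent (iota_uniq 0 j) mC).
by rewrite -addn1 iotaD big_cat/= big_seq1.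
Qed.

(** The cells cut the values of (K, tau) into events of known probability on which
    the ball of radius r of tau is constant. *)
Let cell (r : nat) (x : nat * tree) : set (nat * loctree R) :=
  [set x.1.+1] `*` [set t | truncation r t = x.2].

Let measurable_cell r x : measurable (cell r x).
Proof.
apply: measurableX => //.
by apply: (@measurable_determined _ r) => t s /= ->.
Qed.

Let prob_cell r j (x : nat * tree) : P (X j @^-1` cell r x) =
  (qoo (infinite_pair x.1) *
    expectation q x.1.+1 (fun t => (truncation r t == x.2)%:R))%:E.
Proof.
rewrite (_ : X j @^-1` _ = K j @^-1` [set x.1.+1] `&`
  tau j @^-1` [set t | truncation r t = x.2])//.
rewrite tau_law; last by apply: (@measurable_determined _ r) => t s /= ->.
rewrite K_law EFinM; congr (_ * _)%E.
rewrite /MB /expectation -sumEFin; apply: eq_bigr => y _.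
rewrite EFinM diracE (_ : (y.2 \in _) = (truncation r y.2 == x.2))//.
by apply/idP/eqP; rewrite inE.
Qed.

(** By induction on the number of spine vertices that g sees: on the event that
    the first of them carries a tree with given truncation and size, g only
    depends on the later ones, which are independent of that event. *)
Lemma spine_functional_le_integral M r g j C :
  determined r g -> (forall t, 0 <= g t) -> (forall i, measurable (C i)) ->
  (P (past C j) * (spine_functional q qoo M r g)%:E <=
   \int[P]_(w in past C j) (g (spine j w))%:E)%E.
Proof.
elim: r g j C => [|r IH] g j C gr g0 mC.
  rewrite /=; under eq_integral do rewrite (determined0 _ gr).
  by rewrite integral_cst; [rewrite muleC|exact: (measurable_past j mC)].
pose S k : seq tree := undup [seq truncation r x.2 | x <- outcomes q k.+1].
pose I : seq (nat * tree) := [seq (k, s) | k <- iota 0 M, s <- S k].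
have uI : uniq I.
  apply: allpairs_uniq_dep; first exact: iota_uniq.
    by move=> k _; exact: undup_uniq.
  by move=> [k s] [k' s'] _ _ /= [-> ->].
pose C' x i := if i == j then cell r x else C i.
have mC' x i : measurable (C' x i) by rewrite /C'; case: ifP.
pose D x := past (C' x) j.+1.
have pastC' x : past (C' x) j = past C j.
  rewrite /past; apply: eq_bigcapr => i /= ij.
  by rewrite /C' ltn_eqF.
have DE x : D x = past C j `&` X j @^-1` cell r x.
  by rewrite /D pastS pastC' /C' eqxx.
have mD x : measurable (D x) by exact: measurable_past.
have DS x : D x `<=` past C j by rewrite DE; exact: subIsetl.
have mg i : measurable_fun setT (fun w => (g (spine i w))%:E).
  apply/measurable_EFinP; move=> _ B _; rewrite setTI.
  apply: (@measurable_spine_determined r.+1 (g @^-1` B)).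
  by move=> t s ts; rewrite /preimage/= (gr _ _ ts).
have tD : trivIset [set` I] D.
  move=> [k s] [k' s'] _ _ [w [/=]]; rewrite !DE => -[_ [/= K1 T1]] [_ [/= K2 T2]].
  by move: K1 T1 K2 T2 => /= -> -> [->] ->.
apply: (@le_trans _ _ (\int[P]_(w in \big[setU/set0]_(x <- I) D x) (g (spine j w))%:E)%E);
    last first.
  apply: ge0_subset_integral.
  - exact: bigsetU_measurable.
  - exact: measurable_past.
  - exact: measurable_funTS.
  - by move=> w _; rewrite lee_fin.
  - by apply: (big_ind (fun A => A `<=` past C j)) => // A B AC BC w [/AC|/BC].
rewrite ge0_integral_bigsetU//; last 2 first.
- exact: measurable_funTS.
- by move=> w _; rewrite lee_fin.
have step x : (P (D x) * (spine_functional q qoo M r (fun t => g (join t x.2)))%:E <=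
    \int[P]_(w in D x) (g (spine j w))%:E)%E.
  have -> : (\int[P]_(w in D x) (g (spine j w))%:E =
      \int[P]_(w in D x) (g (join (spine j.+1 w) x.2))%:E)%E.
    apply: eq_integral => w; rewrite inE DE => -[_ [_ /= tx]].
    by rewrite spineE -tx; congr EFin; apply: gr;
      rewrite !truncation_join truncation_truncation.
  by apply: IH => // ; exact: determined_joinl.
apply: le_trans (lee_sum _ (fun x _ => step x)).
have PD x : P (D x) = (P (past C j) * P (X j @^-1` cell r x))%E.
  by rewrite /D prob_pastS// pastC' /C' eqxx.
under eq_bigr do rewrite PD prob_cell -muleA -EFinM.
have qoo0 k : 0 <= qoo (infinite_pair k) by rewrite -lee_fin -(K_law 0%N) measure_ge0.
rewrite -ge0_sume_distrr; last first.
  move=> x _; rewrite lee_fin !mulr_ge0//; first exact: expectation_ge0.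
  exact: spine_functional_ge0.
rewrite lee_wpmul2l// sumEFin lee_fin /I big_allpairs_dep /= /index_iota subn0.
rewrite le_eqVlt; apply/orP; left; apply/eqP; apply: eq_bigr => k _.
under [RHS]eq_bigr do rewrite -mulrA.
rewrite -mulr_sumr; congr (_ * _); rewrite /expectation.
under [RHS]eq_bigr do rewrite mulr_suml.
rewrite exchange_big/=; apply: eq_big_seq => x xk.
rewrite (bigD1_seq (truncation r x.2)) ?undup_uniq//=; last first.
  by rewrite mem_undup; apply: (map_f (fun y => truncation r y.2)).
rewrite eqxx mulr1 [X in _ + X]big1 ?addr0; last first.
  by move=> s; rewrite eq_sym => /negbTE ->; rewrite mulr0 mul0r.
congr (_ * spine_functional _ _ _ _ _); apply/funext => t.
by apply: gr; rewrite !truncation_join truncation_truncation.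
Qed.

Lemma spine_functional_le_law (nu : probability (loctree R) R) M r
    (g : loctree R -> R) :
  (forall A : set (loctree R), measurable A ->
    nu A = P [set w | A (spine_tree (fun n => tau n w))]) ->
  determined r g -> (forall t, 0 <= g t) ->
  ((spine_functional q qoo M r g)%:E <= \int[nu]_t (g t)%:E)%E.
Proof.
move=> nuE gr g0.
have := @spine_functional_le_integral M r g 0 (fun=> setT) gr g0 (fun=> measurableT).
rewrite past0 probability_setT mul1e => /le_trans; apply.
have mg : measurable_fun setT (EFin \o g).
  by apply/measurable_EFinP; exact: measurable_fun_determined gr.
have g0' : {in [set: loctree R], forall t, (0 <= (EFin \o g) t)%E}.
  by move=> t _; rewrite lee_fin.
have := ge0_integral_pushforward (measurable_spine 0) P measurableT mg g0'.
rewrite preimage_setT => <-; rewrite le_eqVlt; apply/orP; left; apply/eqP.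
by apply: eq_measure_integral => A mA _; exact/esym/nuE.
Qed.

End infinite_spine.

Lemma spine_tree_limit (R : realType) (q : split_law R)
    (qoo : infinite_partition -> R) (nu : probability (loctree R) R) :
  (forall k, q n [:: (n - k.+1)%N; k.+1] @[n --> \oo] --> qoo (infinite_pair k)) ->
  \sum_(0 <= k < M) qoo (infinite_pair k) @[M --> \oo] --> (1 : R) ->
  is_MB_infinite_law q qoo nu ->
  weak_cvg (fun n => MB q n) nu.
Proof.
move=> split_cvg qoo_sum [d [T [P [K [tau [mKtau indep K_law tau_law nuE]]]]]].
apply: weak_cvg_determined => r g B gr gB e e0.
have g0 t : 0 <= g t by have /andP[] := gB t.
have lower_nu M h : determined r h -> (forall t, 0 <= h t <= B) ->
    spine_functional q qoo M r h <= \int[nu]_t h t.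
  move=> hr hB.
  have h0 t : 0 <= h t by have /andP[] := hB t.
  have hle t : `|h t| <= B by have /andP[? ?] := hB t; rewrite ger0_norm.
  have mh := measurable_fun_determined hr.
  rewrite -lee_fin -(EFin_Rintegral nu mh hle).
  exact: (spine_functional_le_law mKtau indep K_law tau_law).
have e2 : 0 < e / 2 by rewrite divr_gt0.
(* The constant function B measures the mass lost by bounding the finite parts. *)
have [M hM] : exists M, B - spine_functional q qoo M r (fun=> B) <= e / 2.
  have pow_cvg p :
      (\sum_(0 <= k < M) qoo (infinite_pair k)) ^+ p @[M --> \oo] --> (1 : R).
    elim: p => [|p IH]; first exact: cvg_cst.
    have : (\sum_(0 <= k < M) qoo (infinite_pair k)) *
        (\sum_(0 <= k < M) qoo (infinite_pair k)) ^+ p @[M --> \oo] --> (1 * 1 : R).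
      exact: cvgM.
    rewrite mulr1; apply: cvg_trans.
    by apply: near_eq_cvg; apply: nearW => n; rewrite exprS.
  have lim : B * (\sum_(0 <= k < M) qoo (infinite_pair k)) ^+ r @[M --> \oo] --> B * 1.
    by apply: cvgMr; exact: pow_cvg.
  rewrite mulr1 in lim.
  have /cvgrPdist_le/(_ _ e2)[M _ /(_ M (leqnn M)) hM] := lim.
  by exists M; rewrite spine_functional_cst; exact: le_trans (ler_norm _) hM.
have int_nu : \int[nu]_t g t <= e / 2 + spine_functional q qoo M r g.
  have gle t : `|g t| <= B by have /andP[? ?] := gB t; rewrite ger0_norm.
  have := lower_nu M (fun t => B - g t).
  rewrite spine_functionalB (RintegralBcst _ (measurable_fun_determined gr) gle).
  have Bgr : determined r (fun t => B - g t) by move=> t s /gr ->.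
  have Bg t : 0 <= B - g t <= B.
    by have /andP[? ?] := gB t; rewrite subr_ge0 gerBl; apply/andP.
  by move=> /(_ Bgr Bg); move: hM; lra.
have [u u_cvg u_le] := expectation_lower_bound split_cvg M gr g0.
have /cvgrPdist_le/(_ _ e2) := u_cvg; apply: filterS => n.
have -> : \int[MB q n]_t g t = expectation q n g.
  by rewrite /Rintegral integral_MB//; exact: measurable_fun_determined gr.
by rewrite ler_norml => /andP[_]; have := u_le n; move: int_nu; lra.
Qed.

Theorem proposition5p15 (R : realType) (beta : R) (beta_gtN2 : -2 < beta) :
  (-1 <= beta ->
     weak_cvg (fun n => MB (beta_split beta_gtN2) n)
              \d_(complete_binary_tree : loctree R)) /\
  (beta < -1 ->
     forall nu : probability (loctree R) R,
       is_MB_infinite_law (beta_split beta_gtN2) (beta_infinite_mass beta) nu ->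
       weak_cvg (fun n => MB (beta_split beta_gtN2) n) nu).
Proof.
split=> [beta_geN1|beta_ltN1 nu].
  by apply: binary_tree_limit => k k1; exact: beta_mass_cvg0.
apply: spine_tree_limit; last exact: beta_infinite_mass_sum.
by move=> k; rewrite beta_infinite_massE//; exact: beta_mass_cvg.
Qed.
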